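(* Let $V,H,a,A,\mathcal M,P_u$ satisfy the standing assumptions listed in the context, including (A1)–(A4), let $f\in L_2(0,T;H)$, $u_0\in\mathcal M\cap V$, and let $u\in W^1_2(0,T^*;V,H)$ be a solution of Problem P on a time interval $[0,T^*]$, $0<T^*\le T$. Assume that the continuous representative $u\in C(0,T^*;H)$ satisfies $u(t)\in\mathcal M$ for all $t\in[0,T^* )$. Moreover, assume that $u\in L_\eta(0,T^*;V)$ with $\eta>0$ the exponent in (A4)(b). Then $u$ is the only solution of Problem P on $[0,T^*]$ in the space $W^1_2(0,T^*;V,H)\cap L_\eta(0,T^*;V)$.
   Context: **Spaces and bilinear form.** $V\subseteq H\subseteq V^*$ is a Gelfand triplet of real Hilbert spaces, with $V$ compactly (hence continuously) embedded in $H$. $\langle\cdot,\cdot\rangle:V^*\times V\to\mathbb R$ is the dual pairing and $(\cdot,\cdot)$ the inner product of $H$. $T>0$. For every $t\in[0,T]$, $a(\cdot,\cdot;t):V\times V\to\mathbb R$ is a symmetric bilinear form with constants $\beta,\mu>0$, $L\ge 0$ such that for all $u,v\in V$, $s,t\in[0,T]$: $|a(u,v;t)|\le\beta\|u\|_V\|v\|_V$; $a(u,u;t)\ge\mu\|u\|_V^2$; $|a(u,v;t)-a(u,v;s)|\le L\beta\|u\|_V\|v\|_V|t-s|$. $A(t):V\to V^*$ is the bounded operator with $a(u,v;t)=\langle A(t)u,v\rangle$. **Manifold.** $\mathcal M\subseteq H$ is a set such that for every $u\in\mathcal M$ there is a closed subspace $T_u\mathcal M\subset H$, with $H$-orthogonal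 projection $P_u:H\to T_u\mathcal M$, containing all tangent vectors to $\mathcal M$ at $u$. A tangent vector at $u$ is any $v\in H$ for which there is a (strongly) differentiable curve $\phi:(-\epsilon,\epsilon)\to H$, for some $\epsilon>0$, with $\phi(t)\in\mathcal M$ for all $t$, $\phi(0)=u$, $\phi'(0)=v$; such a curve is called admissible. It is assumed that $\mathcal M\cap V\neq\emptyset$ and $T_u\mathcal M\cap V\ne\emptyset$ for every $u\in\mathcal M\cap V$. **Assumptions.** (A1) $u\in\mathcal M$ implies $su\in\mathcal M$ for all $s>0$. (A2) For every subset $\mathcal M'$ of $\mathcal M$ that is weakly compact in $H$ there exist constants $\kappa=\kappa(\mathcal M')$ and $\epsilon=\epsilon(\mathcal M')>0$ such that $\|P_u-P_v\|_{H\to H}\le\kappa\|u-v\|_H$ and $\|(I-P_u)(u-v)\|_H\le\kappa\|u-v\|_H^2$ for all $u,v\in\mathcal M'$ with $\|u-v\|_H\le\epsilon$. (A3) (a) For $u\in\mathcal M\cap V$ and $v\in T_u\mathcal M\cap V$, an admissible curve with $\phi(0)=u$, $\phi'(0)=v$ can be chosen such that $\phi(t)\in\mathcal M\cap V$ for all $|t|$ small enough. (b) If $u\in\mathcal M\cap V$ and $v\in V$, then $P_uv\in T_u\mathcal M\cap V$. (A4) $A(t)=A_1(t)+A_2(t)$ such that for all $t\in[0,T]$: (a) $\langle A_1(t)u,v\rangle=\langle A_1(t)u,P_uv\rangle$ for all $u\in\mathcal M\cap V$, $v\in V$; (b) there is an exponent $\eta>0$ such that for every subset $\mathcal M'$ of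 $\mathcal M$ that is weakly compact in $H$ there exists $\gamma=\gamma(\mathcal M')>0$ with $A_2(t)u\in H$ and $\|A_2(t)u\|_H\le\gamma\|u\|_V^\eta$ for all $u\in\mathcal M'\cap V$ ($\eta$ is independent of $\mathcal M'$). **Function spaces.** $W^1_2(0,S;V,H)=\{u\in L_2(0,S;V):u'\in L_2(0,S;H)\}$; every element has a continuous representative in $C(0,S;H)$, the continuous functions $[0,S]\to H$. **Problem P on $[0,S]$** ($0<S\le T$). Given $f\in L_2(0,T;H)$ and $u_0\in\mathcal M\cap V$, find $u\in W^1_2(0,S;V,H)$ such that $u(0)=u_0$ and, for almost all $t\in[0,S]$, $u(t)\in\mathcal M$ and $$\langle u'(t),v\rangle+a(u(t),v;t)=\langle f(t),v\rangle\quad\text{for all }v\in T_{u(t)}\mathcal M\cap V .$$ *)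

(* Defs.v *)
From HB Require Import structures.
From mathcomp Require Import all_boot all_order all_algebra.
From mathcomp Require Import all_classical all_reals all_analysis.
Set Implicit Arguments.
Unset Strict Implicit.
Unset Printing Implicit Defensive.
Import Order.TTheory GRing.Theory Num.Theory.
Import numFieldNormedType.Exports.
Local Open Scope classical_set_scope.
Local Open Scope ring_scope.

(* Hilbert spaces are complete normed modules with a positive definite
   symmetric form [ip : {dot X for idfun}] that induces the norm.
   V is a space of its own, and the inclusion of V in H is an injective linear
   map j: "x is in V" reads [range j x], and the inclusion of H in V^* sends h
   to the functional v |-> ip h (j v). *)
Definition induces_norm (R : realType) (X : normedModType R)
  (ip : {dot X for idfun}) : Prop := forall x, ip x x = `|x| ^+ 2.

Definition dual (R : realType) (X : normedModType R) : Type :=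
  {l : {scalar X} | continuous l}.

Definition pairing (R : realType) (X : normedModType R) (l : dual X) (x : X) : R
  := proj1_sig l x.

Definition gelfand_compact (R : realType) (V H : normedModType R)
  (j : {linear V -> H}) : Prop :=
  [/\ injective j,
      forall B : set V, bounded_set B -> precompact (j @` B)
    & dense (range j)].

Definition weak (R : realType) (X : normedModType R) : topologicalType :=
  initial_topology ((fun x l => pairing l x) : X -> {ptws dual X -> R}).

Definition weakly_compact (R : realType) (X : normedModType R) (K : set X)
  : Prop := compact (K : set (weak X)).

Definition opnorm (R : realType) (X Y : normedModType R) (B : X -> Y) : \bar R
  := ereal_sup [set `|B x|%:E | x in [set x | `|x| <= 1]].

Definition form_assumptions (R : realType) (V : normedModType R) (T : R)
  (a : R -> {symmetric V}) (beta mu L : R) : Prop :=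
  [/\ [/\ 0 < beta, 0 < mu & 0 <= L],
      forall (t : R) u v, t \in `[0, T] -> `|a t u v| <= beta * `|u| * `|v|,
      forall (t : R) u, t \in `[0, T] -> mu * `|u| ^+ 2 <= a t u u
    & forall (s t : R) u v, s \in `[0, T] -> t \in `[0, T] ->
        `|a t u v - a s u v| <= L * beta * `|u| * `|v| * `|t - s|].

Definition represents_form (R : realType) (V : normedModType R) (T : R)
  (a : R -> {symmetric V}) (A : R -> V -> dual V) : Prop :=
  forall (t : R) u v, t \in `[0, T] -> a t u v = pairing (A t u) v.

Definition closed_subspace (R : realType) (X : normedModType R) (S : set X)
  : Prop :=
  [/\ closed S, S 0 & forall (c : R) x y, S x -> S y -> S (c *: x + y)].

Definition orthogonal_projection (R : realType) (X : normedModType R)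
  (ip : {dot X for idfun}) (S : set X) (P : X -> X) : Prop :=
  forall x, S (P x) /\ forall y, S y -> ip (x - P x) y = 0.

Definition admissible (R : realType) (H : normedModType R) (M : set H)
  (u v : H) (phi : R -> H) : Prop :=
  exists e : R, [/\ 0 < e,
    forall t : R, `|t| < e -> derivable phi t 1 /\ M (phi t),
    phi 0 = u & derive1 phi 0 = v].

Definition tangent_vector (R : realType) (H : normedModType R) (M : set H)
  (u v : H) : Prop := exists phi : R -> H, admissible M u v phi.

Definition manifold_assumptions (R : realType) (V H : normedModType R)
  (ip : {dot H for idfun}) (j : {linear V -> H}) (M : set H)
  (TM : H -> set H) (P : H -> H -> H) : Prop :=
  [/\ forall u, M u -> [/\ closed_subspace (TM u),
                         orthogonal_projection ip (TM u) (P u)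
                       & tangent_vector M u `<=` TM u],
      (M `&` range j) !=set0
    & forall u, M u -> range j u -> (TM u `&` range j) !=set0].

Definition assumption_A1 (R : realType) (H : normedModType R) (M : set H)
  : Prop := forall (u : H) (s : R), M u -> 0 < s -> M (s *: u).

Definition assumption_A2 (R : realType) (H : normedModType R) (M : set H)
  (P : H -> H -> H) : Prop :=
  forall M' : set H, M' `<=` M -> weakly_compact M' ->
  exists kappa eps : R, 0 < eps /\
  forall u v, M' u -> M' v -> `|u - v| <= eps ->
    (opnorm (P u \- P v)%R <= (kappa * `|u - v|)%:E)%E /\
    `|(u - v) - P u (u - v)| <= kappa * `|u - v| ^+ 2.

Definition assumption_A3 (R : realType) (V H : normedModType R)
  (j : {linear V -> H}) (M : set H) (TM : H -> set H) (P : H -> H -> H)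
  : Prop :=
  (forall u v, M u -> range j u -> TM u v -> range j v ->
    exists2 phi : R -> H, admissible M u v phi &
      \forall t \near (0 : R), M (phi t) /\ range j (phi t)) /\
  (forall u v, M u -> range j u -> range j v ->
    TM u (P u v) /\ range j (P u v)).

(* In the second item z is P_u v seen as an element of V, and in the third h is
   A_2(t)u seen as an element of H. *)
Definition assumption_A4 (R : realType) (V H : normedModType R)
  (ip : {dot H for idfun}) (j : {linear V -> H}) (M : set H)
  (P : H -> H -> H) (T : R) (A A1 A2 : R -> V -> dual V) (eta : R) : Prop :=
  [/\ forall (t : R) u v, t \in `[0, T] ->
        pairing (A t u) v = pairing (A1 t u) v + pairing (A2 t u) v,
      forall (t : R) u v z, t \in `[0, T] -> M (j u) -> j z = P (j u) (j v) ->
        pairing (A1 t u) v = pairing (A1 t u) z,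
      0 < eta
    & forall M' : set H, M' `<=` M -> weakly_compact M' ->
      exists2 gamma : R, 0 < gamma &
      forall (t : R) u, t \in `[0, T] -> M' (j u) ->
      exists2 h : H, (forall v, pairing (A2 t u) v = ip h (j v)) &
                     `|h| <= gamma * `|u| `^ eta].

(* Functions on (0, S) are total functions on R whose values outside [0, S]
   are irrelevant; equality of classes is almost everywhere equality. *)
Definition aeI (R : realType) (S : R) (Q : R -> Prop) : Prop :=
  {ae (@lebesgue_measure R), forall t, `[0, S]%classic t -> Q t}.

Definition simple_fun (R : realType) (X : normedModType R) (s : R -> X)
  : Prop :=
  finite_set (range s) /\ forall x, measurable (s @^-1` [set x]).

Definition simple_integral (R : realType) (X : normedModType R) (S : R)
  (s : R -> X) : X :=
  \sum_(x \in range s)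
    fine (lebesgue_measure (`[0, S]%classic `&` s @^-1` [set x])) *: x.

Definition strongly_measurable (R : realType) (X : normedModType R) (S : R)
  (f : R -> X) : Prop :=
  exists s : nat -> R -> X, (forall n, simple_fun (s n)) /\
    aeI S (fun t => s n t @[n --> \oo] --> f t).

Definition bochner_integral (R : realType) (X : normedModType R) (S : R)
  (f : R -> X) (I : X) : Prop :=
  strongly_measurable S f /\
  exists s : nat -> R -> X, [/\ forall n, simple_fun (s n),
    (\int[lebesgue_measure]_(t in `[0%R, S]) (`|s n t - f t|)%:E)%E
      @[n --> \oo] --> 0%E
  & simple_integral S (s n) @[n --> \oo] --> I].

Definition in_Lp (R : realType) (X : normedModType R) (S p : R) (f : R -> X)
  : Prop :=
  strongly_measurable S f /\
  (\int[lebesgue_measure]_(t in `[0%R, S]) (`|f t| `^ p)%:E < +oo)%E.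

Definition test_function (R : realType) (S : R) (phi : R -> R) : Prop :=
  (forall n (t : R), derivable (derive1n n phi) t 1) /\
  exists a b : R, [/\ 0 < a, b < S &
    forall t : R, phi t != 0 -> t \in `[a, b]].

Definition weak_derivative (R : realType) (X : normedModType R) (S : R)
  (x w : R -> X) : Prop :=
  forall phi, test_function S phi -> exists I : X,
    bochner_integral S (fun t => derive1 phi t *: x t) I /\
    bochner_integral S (fun t => phi t *: w t) (- I).

(* u is in W^1_2(0, S; V, H), with u' = w. *)
Definition W12 (R : realType) (V H : normedModType R) (j : {linear V -> H})
  (S : R) (u : R -> V) (w : R -> H) : Prop :=
  [/\ in_Lp S 2 u, in_Lp S 2 w & weak_derivative S (j \o u) w].

Definition continuous_representative (R : realType) (X : normedModType R)
  (S : R) (x xc : R -> X) : Prop :=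
  {within `[0, S], continuous xc} /\ aeI S (fun t => xc t = x t).

Definition solution_P (R : realType) (V H : normedModType R)
  (ip : {dot H for idfun}) (j : {linear V -> H}) (a : R -> {symmetric V})
  (M : set H) (TM : H -> set H) (f : R -> H) (u0 : V) (S : R) (u : R -> V)
  : Prop :=
  exists w : R -> H, [/\ W12 j S u w,
    exists2 uc, continuous_representative S (j \o u) uc & uc 0 = j u0
  & aeI S (fun t => M (j (u t)) /\
      forall v : V, TM (j (u t)) (j v) ->
        ip (w t) (j v) + a t (u t) v = ip (f t) (j v))].

(* Main.v *)
Require Import Defs.
From mathcomp Require Import all_boot all_order all_algebra.
From mathcomp Require Import all_classical all_reals all_analysis.
From mathcomp Require Import measurable_realfun ring lra.
Import Order.TTheory GRing.Theory Num.Theory.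
Import numFieldNormedType.Exports.
Local Open Scope classical_set_scope.
Local Open Scope ring_scope.

Set Implicit Arguments.
Unset Strict Implicit.

(* Let d = u - v and E = |d|^2. Testing the equation of u with P_u d and that of
   v with P_v d, and using (A4)(a), gives almost everywhere
     (u', P_u d) - (v', P_v d) <= (f, (P_u - P_v) d)
       + (A_2 u, (I - P_u) d) - (A_2 v, (I - P_v) d) <= c G |d|^2,
   where G is integrable and c comes from (A2) and (A4)(b).
   The solution v lies in M only for almost every t, so there is no weakly
   compact subset of M containing all its values. But a convergent sequence with
   its limit is weakly compact, hence the constants of (A2) and (A4)(b) are
   uniform on M near each point of M; this is applied at the point where u and v
   are supposed to separate, which is in M because u(t) is for every t.
   That u' is tangential, so that (u', d) = (u', P_u d), is not proved pointwise:
   on a short interval [s, t], (A2) bounds (I - P_{u(s)})(u(t) - u(s)) by a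
   multiple of |u(t) - u(s)|^2, whence
     E(t) - E(s) <= 2 c m I + K I^2,  I the integral of G over [s, t], m = max E.
   Summing over fine partitions with nodes in a set of full measure removes the
   quadratic term, and m <= m / 2 on a short interval forces d = 0 there. *)

(** * A smooth step function *)

(** Derivatives are explicit witnesses, so that sums, products, inverses and affine substitutions
    follow by induction on [n] from the [is_derive] rules; [ndiff_derive1n] converts to the form
    used by [test_function]. *)
Fixpoint ndiff (R : realType) (n : nat) (f : R -> R) : Prop :=
  if n is m.+1 then
    exists2 f' : R -> R, (forall x, is_derive x (1 : R) f (f' x)) & ndiff m f'
  else True.

Section ndiff.
Context {R : realType}.
Implicit Types (f g : R -> R) (n : nat).

Lemma ndiff_derive1n f : (forall n, ndiff n f) ->
  forall n (t : R), derivable (derive1n n f) t 1.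
Proof.
move=> + n; elim: n f => [|n IH] f fn t.
  by have [f' ff' _] := fn 1%N; have [] := ff' t.
rewrite derive1Sn; apply: IH => m; have [f' ff' f'm] := fn m.+1.
suff -> : derive1 f = f' by [].
by apply/funext => x; have [_ <-] := ff' x; rewrite derive1E.
Qed.

Lemma ndiffW n f : ndiff n.+1 f -> ndiff n f.
Proof.
by elim: n f => // n IH f [f' ff' /IH f'n]; exists f'.
Qed.

Lemma ndiff_cst n (c : R) : ndiff n (fun=> c).
Proof.
by elim: n c => // n IH c; exists (fun=> 0) => // x; exact: is_derive_cst.
Qed.

Lemma ndiffD n f g : ndiff n f -> ndiff n g -> ndiff n (fun x => f x + g x).
Proof.
elim: n f g => // n IH f g [f' ff' f'n] [g' gg' g'n].
by exists (fun x => f' x + g' x); [move=> x; exact: is_deriveD|exact: IH].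
Qed.

Lemma ndiffM n f g : ndiff n f -> ndiff n g -> ndiff n (fun x => f x * g x).
Proof.
elim: n f g => // n IH f g fn gn.
case: (fn) (gn) => [f' ff' f'n] [g' gg' g'n].
exists (fun x => f x * g' x + g x * f' x).
  by move=> x; exact: is_deriveM.
by apply: ndiffD; apply: IH => //; exact: ndiffW.
Qed.

Lemma ndiffZ n (c : R) f : ndiff n f -> ndiff n (fun x => c * f x).
Proof. by move=> fn; apply: ndiffM => //; exact: ndiff_cst. Qed.

Lemma ndiff_affine n f (c e : R) : ndiff n f -> ndiff n (fun x => f (c * x + e)).
Proof.
elim: n f => // n IH f [f' ff' f'n].
exists (fun x => c * f' (c * x + e)); last by apply: ndiffZ; exact: IH.
move=> x.
have h : is_derive x (1 : R) (fun y => c * y + e) c.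
  have := is_deriveD (is_deriveZ c (is_derive_id x (1:R))) (is_derive_cst e x (1:R)).
  by rewrite addr0 [_ *: _]mulr1.
have := @is_derive1_comp _ f (fun y => c * y + e) x _ _ (ff' (c * x + e)) h.
by rewrite mulrC.
Qed.

(** The derivative - f' / f ^ 2 contains the inverse itself, which the induction hypothesis covers
    at order [n]. *)
Lemma ndiffV n f : (forall x, f x != 0) -> ndiff n f ->
  ndiff n (fun x => (f x)^-1).
Proof.
move=> f0; elim: n => // n IH fn; have [f' ff' f'n] := fn.
exists (fun x => -1 * (((f x)^-1 * (f x)^-1) * f' x)).
  move=> x; have := is_deriveV (f0 x) (ff' x).
  by rewrite -exprVn expr2 scaleNr mulN1r.
have fVn := IH (ndiffW fn).
by apply: ndiffZ; apply: ndiffM => //; exact: ndiffM.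
Qed.

(* Up to linear combinations, this family is closed under derivation. *)
Definition flat (k : nat) (x : R) : R :=
  if 0 < x then x ^- k * expR (- x^-1) else 0.

Lemma flat_ge0 k x : 0 <= flat k x.
Proof.
rewrite /flat; case: ifPn => // x0.
by rewrite mulr_ge0// ?expR_ge0// invr_ge0 exprn_ge0// ltW.
Qed.

Lemma flat_gt0 k x : 0 < x -> 0 < flat k x.
Proof.
by move=> x0; rewrite /flat x0 mulr_gt0// ?expR_gt0// invr_gt0 exprn_gt0.
Qed.

Lemma flat_le0 k x : x <= 0 -> flat k x = 0.
Proof. by rewrite /flat leNgt => /negbTE ->. Qed.

(** With y = 1 / x this reads y ^ (k+1) <= (k+1)! e ^ y, which bounds one term of the exponential
    series by its sum. *)
Lemma flat_le k x : 0 <= x -> flat k x <= (k.+1)`!%:R * x.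
Proof.
rewrite le_eqVlt => /predU1P[<-|x0]; first by rewrite flat_le0// mulr0.
rewrite /flat x0 expRN -exprVn -[in leRHS](invrK x).
have y0 : 0 < x^-1 by rewrite invr_gt0.
move: (x^-1) y0 => y y0.
rewrite ler_pdivrMr ?expR_gt0// mulrAC ler_pdivlMr// -exprSr mulrC.
rewrite -ler_pdivrMr ?ltr0n ?fact_gt0//.
by apply: le_trans (expR_ge1Dxn k (ltW y0)); rewrite lerDr.
Qed.

Lemma is_derive_flat k (x : R) :
  is_derive x (1 : R) (flat k) (- k%:R * flat k.+1 x + flat k.+2 x).
Proof.
have [x0|x0|->] := ltgtP x 0.
- rewrite !flat_le0 ?(ltW x0)// mulr0 addr0.
  have near0 : \near x, cst 0 x = flat k x.
    by near=> y; rewrite flat_le0// ltW//; near: y; exact: lt_nbhsl.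
  exact: near_eq_is_derive near0 (is_derive_cst (0 : R) x (1 : R)).
- have nearp : \near x, (((fun y : R => y^-1) ^+ k) * (expR \o (fun y : R => - (y^-1)))) x = flat k x.
    near=> y; rewrite /flat ifT; first by rewrite fctE exprfctE /= exprVn.
    by near: y; exact: lt_nbhsr.
  apply: near_eq_is_derive nearp _.
  have xn0 : x != 0 by rewrite gt_eqF.
  have d1 : is_derive x (1:R) (fun y : R => y^-1) (- x ^- 2).
    have := is_deriveV (xn0 : id x != 0) (is_derive_id x (1:R)).
    by rewrite [_ *: _]mulr1.
  have d2 := @is_derive1_comp _ expR (fun y : R => - (y^-1)) x _ _ (is_derive_expR (- x^-1)) (is_deriveN d1).
  have d3 := is_deriveX k d1.
  apply: is_derive_eq (is_deriveM d3 d2) _.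
  rewrite /flat x0 -!exprVn.
  rewrite fctE /GRing.scale /=.
  by case: k {d3} => [|k] /=; [rewrite !mul0r|rewrite !exprS]; ring.
(* At 0 the difference quotient is zero on the left and [flat k.+1 h] on the right, which [flat_le]
   bounds by a multiple of [h]. *)
- have lim0 : h^-1 *: ((flat k \o shift 0) (h *: 1) - flat k 0) @[h --> (0:R)^'] --> (0 : R).
    apply/cvgrPdist_le => e e0; near=> h.
    rewrite /= addr0 [h *: 1]mulr1 [flat k 0]flat_le0// subr0 sub0r normrN.
    have [h0|h0] := leP h 0; first by rewrite flat_le0// scaler0 normr0 ltW.
    rewrite ger0_norm; last first.
      by apply: mulr_ge0; rewrite ?flat_ge0// invr_ge0 ltW.
    have -> : h^-1 *: flat k h = flat k.+1 h.
      by rewrite /flat h0 exprS invfM -mulrA.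
    apply: le_trans (flat_le _ (ltW h0)) _.
    rewrite mulrC -ler_pdivlMr ?ltr0n ?fact_gt0// -[leLHS]ger0_norm ?(ltW h0)//.
    near: h; apply: dnbhs0_le; by rewrite divr_gt0// ltr0n fact_gt0.
  rewrite !flat_le0// mulr0 addr0; apply: DeriveDef.
    by apply/cvg_ex; exists 0.
  exact: cvg_lim lim0.
Unshelve. all: by end_near. Qed.

Lemma ndiff_flat n k : ndiff n (flat k).
Proof.
elim: n k => // n IH k.
exists (fun x => - k%:R * flat k.+1 x + flat k.+2 x).
  exact: is_derive_flat.
by apply: ndiffD => //; exact: ndiffZ.
Qed.

(** The function is p / (p + q), where p(x) is exp(- 1 / x) for positive x and zero otherwise, and
    q(x) = p(1 - x). The denominator is positive because x or 1 - x is. *)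
Lemma smooth_step : exists B B' : R -> R,
  [/\ forall n, ndiff n B, forall x : R, is_derive x (1 : R) B (B' x),
      continuous B' & forall x,
      [/\ 0 <= B x <= 1, x <= 0 -> B x = 0, 1 <= x -> B x = 1, 0 <= B' x &
          B' x != 0 -> 0 < x < 1]].
Proof.
pose p := flat 0; pose q x := flat 0 (- 1 * x + 1).
have pq_gt0 x : 0 < p x + q x.
  have [x0|x0] := ltP 0 x; first by rewrite ltr_pwDl ?flat_gt0 ?flat_ge0.
  by rewrite ltr_wpDl ?flat_ge0// flat_gt0//; lra.
pose B x := p x * (p x + q x)^-1.
have Bn n : ndiff n B.
  apply: ndiffM; first exact: ndiff_flat.
  apply: ndiffV; first by move=> x; rewrite gt_eqF.
  apply: ndiffD; first exact: ndiff_flat.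
  by apply: (@ndiff_affine n (flat 0) (-1) 1); exact: ndiff_flat.
(* [flat 2] is the derivative of [flat 0]. The reflection in [q] changes the sign of its derivative,
   so both terms of the quotient rule are nonnegative. *)
pose B' x := (flat 2 x * q x + p x * flat 2 (- 1 * x + 1)) / (p x + q x) ^+ 2.
have dB x : is_derive x (1 : R) B (B' x).
  have dp := is_derive_flat 0 x.
  have dl : is_derive x (1 : R) (fun y => -1 * y + 1) (-1).
    have := is_deriveD (is_deriveZ (-1 : R) (is_derive_id x (1:R))) (is_derive_cst (1 : R) x (1:R)).
    by rewrite addr0 [_ *: _]mulr1.
  have dq := @is_derive1_comp _ (flat 0) _ x _ _ (is_derive_flat 0 (-1 * x + 1)) dl.
  have pq0 : (p + q) x != 0 by rewrite gt_eqF//; exact: pq_gt0.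
  have := is_deriveM dp (is_deriveV pq0 (is_deriveD dp dq)).
  have -> : (flat 0 * (fun y => ((p + q) y)^-1))%R = B by apply/funext.
  move=> h; apply: is_derive_eq h _.
  rewrite /B' /GRing.scale /= !oppr0 !mul0r !add0r.
  have := pq_gt0 x; rewrite /p /q fctE /=.
  set a := flat 0 x; set b := flat 0 _; set c := flat 2 x; set d := flat 2 _ => ab.
  by field; rewrite gt_eqF.
exists B, B'; split=> // [x|x].
  have [B'' dB'' [B3 dB3 _]] := Bn 2%N.
  have <- : B'' = B'.
    by apply/funext => y; have [_ <-] := dB'' y; have [_ <-] := dB y.
  by apply/differentiable_continuous/derivable1_diffP; have [] := dB3 x.
have p0 := flat_ge0 0 x; have q0 := flat_ge0 0 (-1 * x + 1).
split.
- apply/andP; split; first by rewrite divr_ge0// ltW.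
  by rewrite ler_pdivrMr// mul1r; rewrite /p /q; lra.
- by move=> x0; rewrite /B /p flat_le0// mul0r.
- move=> x1; have qx : q x = 0 by rewrite /q flat_le0//; lra.
  by rewrite /B qx addr0 divff// gt_eqF//; have := pq_gt0 x; rewrite qx addr0.
- by rewrite mulr_ge0 ?invr_ge0 ?exprn_ge0 ?addr_ge0 ?mulr_ge0 ?flat_ge0 ?ltW.
- apply: contraNT; rewrite negb_and -!leNgt => /orP[x0|x1].
    by rewrite /B' /p !(flat_le0 _ x0) !mul0r addr0 mul0r.
  have x1' : -1 * x + 1 <= 0 by lra.
  by rewrite /B' /q !(flat_le0 _ x1') !mulr0 addr0 mul0r.
Qed.
End ndiff.

(** * Inner products and orthogonal projections *)

Section ip.
Context {R : realType} {H : normedModType R} (ip : {dot H for idfun}) (hip : induces_norm ip).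

Lemma ipC x y : ip x y = ip y x.
Proof. by rewrite hermC expr0 mul1r. Qed.

Lemma ipZl c x y : ip (c *: x) y = c * ip x y.
Proof. by rewrite linearZl_LR. Qed.

Lemma ipZr c x y : ip x (c *: y) = c * ip x y.
Proof. by rewrite ipC ipZl ipC. Qed.

Lemma ipDl x y z : ip (x + y) z = ip x z + ip y z.
Proof. by rewrite linearDl. Qed.
Lemma ipNl x z : ip (- x) z = - ip x z.
Proof. by rewrite linearNl. Qed.
Lemma ipBl x y z : ip (x - y) z = ip x z - ip y z.
Proof. by rewrite linearBl. Qed.
Lemma ipBr x y z : ip z (x - y) = ip z x - ip z y.
Proof. by rewrite ipC ipBl !(ipC z). Qed.

(** Cauchy-Schwarz: the squared norm of |y|^2 x - (x, y) y equals |y|^2 (|x|^2 |y|^2 - (x, y)^2). *)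
Lemma le_ip x y : `|ip x y| <= `|x| * `|y|.
Proof.
have [->|y0] := eqVneq y 0.
  by rewrite (_ : ip x 0 = 0) ?normr0 ?mulr0// -(subrr 0) ipBr subrr.
have yy : 0 < `|y| ^+ 2 by rewrite exprn_gt0// normr_gt0.
have : 0 <= ip (`|y| ^+ 2 *: x - ip x y *: y) (`|y| ^+ 2 *: x - ip x y *: y).
  by rewrite hip exprn_ge0.
rewrite ipBl !ipBr !ipZl !ipZr (ipC y x) (hip x) (hip y) => h.
rewrite -(@ler_pXn2r _ 2) ?nnegrE ?mulr_ge0// real_normK ?num_real// exprMn.
rewrite -subr_ge0 -(pmulr_rge0 _ yy).
by apply: le_trans h _; rewrite le_eqVlt; apply/orP; left; apply/eqP; ring.
Qed.

Lemma ip_le x y : ip x y <= `|x| * `|y|.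
Proof. exact: le_trans (ler_norm _) (le_ip _ _). Qed.

Lemma ip_continuous z : continuous (ip^~ z).
Proof.
move=> x; apply/cvgrPdist_le => e e0.
near=> y.
rewrite -ipBl; apply: le_trans (le_ip _ _) _.
apply: (@le_trans _ _ (`|x - y| * (`|z| + 1))).
  by rewrite ler_wpM2l// lerDl.
rewrite -ler_pdivlMr ?ltr_wpDl//.
near: y; apply: cvgr_dist_le; first exact: cvg_id.
by rewrite divr_gt0// ltr_wpDl.
Unshelve. all: by end_near. Qed.
End ip.

Section projection.
Context {R : realType} {H : normedModType R} (ip : {dot H for idfun}).
Hypothesis (hip : induces_norm ip).
Variables (S : set H) (P : H -> H).
Hypotheses (hS : closed_subspace S) (hP : orthogonal_projection ip S P).

Let SB x y : S x -> S y -> S (x - y).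
Proof. by case: hS => _ _ h Sx Sy; rewrite addrC -scaleN1r; exact: h. Qed.

(** [P x - y] lies in [S] and is orthogonal to [S], hence to itself. Linearity of [P], which is not
    part of its definition, is derived from this. *)
Lemma proj_unique x y : S y -> (forall z, S z -> ip (x - y) z = 0) -> P x = y.
Proof.
move=> Sy h; apply/eqP; rewrite -subr_eq0 -normr_eq0 -sqrf_eq0 -hip.
have Spy : S (P x - y) by apply: SB => //; exact: (hP x).1.
rewrite {1}(_ : P x - y = (x - y) - (x - P x)); last first.
  by rewrite opprB (addrC (x - y)) addrA subrK.
by rewrite ipBl h// (hP x).2// subrr.
Qed.

Lemma projD c x y : P (c *: x + y) = c *: P x + P y.
Proof.
have [_ _ hl] := hS.
apply: proj_unique; first by apply: hl; exact: (hP _).1.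
move=> z Sz.
rewrite (_ : _ - _ = c *: (x - P x) + (y - P y)); last first.
  by rewrite scalerBr opprD addrACA.
by rewrite ipDl ipZl !(hP _).2// mulr0 addr0.
Qed.

Lemma projB x y : P (x - y) = P x - P y.
Proof. by rewrite [x - y]addrC -(scaleN1r y) projD scaleN1r [LHS]addrC. Qed.

Lemma proj0 : P 0 = 0.
Proof. by have := projB 0 0; rewrite !subrr. Qed.

Lemma projZ c x : P (c *: x) = c *: P x.
Proof. by rewrite -[c *: x]addr0 projD proj0 addr0. Qed.

Lemma projN x : P (- x) = - P x.
Proof. by rewrite -scaleN1r projZ scaleN1r. Qed.

(** (A2) bounds the normal part of a difference that starts with the base point; by oddness the
    order of the two points does not matter. *)
Lemma proj_defectC x y : `|x - y - P (x - y)| = `|y - x - P (y - x)|.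
Proof. by rewrite -(opprB x y) projN -opprD normrN. Qed.

Lemma proj_sym x y : ip (P x) y = ip x (P y).
Proof.
have h1 : ip (x - P x) (P y) = 0 by apply: (hP x).2; exact: (hP y).1.
have h2 : ip (y - P y) (P x) = 0 by apply: (hP y).2; exact: (hP x).1.
rewrite !ipBl in h1, h2.
by rewrite (ipC _ (P x)) (subr0_eq h2) (subr0_eq h1) ipC.
Qed.

Lemma proj_le x : `|P x| <= `|x|.
Proof.
have [->|Px0] := eqVneq (P x) 0; first by rewrite normr0.
have h : ip (x - P x) (P x) = 0 by apply: (hP x).2; exact: (hP x).1.
have Pp : 0 < `|P x| by rewrite normr_gt0.
rewrite -(ler_pM2r Pp) -expr2 -hip.
by rewrite ipBl in h; rewrite -(subr0_eq h); exact: ip_le.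
Qed.
End projection.

Lemma opnorm_le {R : realType} {X Y : normedModType R} (B : X -> Y) (c : R) x :
  (forall k x, B (k *: x) = k *: B x) -> (opnorm B <= c%:E)%E ->
  `|B x| <= c * `|x|.
Proof.
move=> BZ h; have [->|x0] := eqVneq x 0.
  by rewrite -(scale0r (0:X)) BZ !scale0r !normr0 mulr0.
have xp : 0 < `|x| by rewrite normr_gt0.
have : (`|B (`|x|^-1 *: x)|%:E <= opnorm B)%E.
  apply: ereal_sup_ubound; exists (`|x|^-1 *: x) => //=.
  by rewrite normrZ normfV normr_id mulVf// gt_eqF.
move=> /le_trans/(_ h); rewrite lee_fin BZ normrZ normfV normr_id.
by rewrite mulrC ler_pdivrMr.
Qed.

(** * Constants that are uniform on weakly compact sets *)

Lemma compact_cvg_seq (X : topologicalType) (x : nat -> X) (z : X) :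
  x n @[n --> \oo] --> z -> compact (z |` range x).
Proof.
move=> xz F PF FK.
have [zF|] := pselect (cluster F z); first by exists z; split => //; left.
(* If [z] is not a cluster point, some member of [F] misses a neighbourhood of [z]. Only finitely
   many terms lie outside that neighbourhood, so [F] contains a finite set, and finite sets are
   compact. *)
move=> /existsNP[A /existsNP[B /not_implyP[FA /not_implyP[zB AB0]]]].
have [N _ NB] := xz _ zB.
have FA' : F (x @` `I_N).
  apply: filterS (filterI FK FA) => y [[->|[n _ <-]] Ay].
    by exfalso; apply: AB0; exists z; split => //; exact: nbhs_singleton.
  have [nN|Nn] := ltnP n N; first by exists n.
  by exfalso; apply: AB0; exists (x n); split => //; exact: NB.
have [] := @finite_compact _ (x @` `I_N) _ F PF FA'.
  by apply: finite_image; exact: finite_II.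
by move=> y [[n _ <-] cl]; exists (x n); split => //; right; exists n.
Qed.

Lemma cvg_initial (S : choiceType) (T : topologicalType) (f : S -> T)
    (x : nat -> S) (z : S) :
  f (x n) @[n --> \oo] --> f z ->
  (x n : initial_topology f) @[n --> \oo] --> (z : initial_topology f).
Proof.
move=> fxz A; rewrite nbhsE => -[B [[C oC <-] Cz]] BA.
have fzC : nbhs (f z) C by apply: open_nbhs_nbhs.
have [N _ NC] := fxz C fzC.
by exists N => // n Nn; apply: BA; exact: NC.
Qed.

(** The weak topology is initial for the evaluation into a product, and the product topology is a
    supremum of initial ones. Two uses of [cvg_initial] leave convergence of [pairing l (x n)] for
    each [l]. *)
Lemma weak_cvg (R : realType) (X : normedModType R) (x : nat -> X) (z : X) :
  x n @[n --> \oo] --> z ->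
  (x n : weak X) @[n --> \oo] --> (z : weak X).
Proof.
move=> xz.
apply: (@cvg_initial _ {ptws dual X -> R} (fun x l => pairing l x) x z).
apply/cvg_sup => l.
apply: (@cvg_initial _ _ (fun g : dual X -> R => g l)
  (fun n l => pairing l (x n)) (fun l => pairing l z)).
exact: (cvg_comp _ _ xz (proj2_sig l z)).
Qed.

Lemma weakly_compact_cvg_seq (R : realType) (X : normedModType R)
    (x : nat -> X) (z : X) :
  x n @[n --> \oo] --> z -> weakly_compact (z |` range x).
Proof. by move=> xz; apply: compact_cvg_seq; exact: weak_cvg. Qed.

(* A sequence together with its limit is weakly compact, so constants that are
   uniform on weakly compact subsets of M are uniform near each point of M. *)
Lemma local_constant (R : realType) (H : normedModType R) (M : set H)
    (Q : nat -> H -> H -> Prop) (z : H) :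
  (forall k l x y, (k <= l)%N -> Q k x y -> Q l x y) ->
  (forall M', M' `<=` M -> weakly_compact M' ->
    exists k, forall x y, M' x -> M' y -> Q k x y) ->
  M z ->
  exists k, exists2 d : R, 0 < d &
    forall x y, M x -> M y -> `|x - z| < d -> `|y - z| < d -> Q k x y.
Proof.
move=> Qle QM Mz; apply: contrapT => nQ.
(* If no constant works near [z], each [n] yields a pair within 1 / (n+1) of [z] that violates
   [Q n]. Both components converge to [z]. *)
have /choice[xy xyP] : forall n, exists xy : H * H,
    [/\ M xy.1, M xy.2, `|xy.1 - z| < n.+1%:R^-1, `|xy.2 - z| < n.+1%:R^-1 &
    ~ Q n xy.1 xy.2].
  move=> n; apply: contrapT => nxy; apply: nQ; exists n, n.+1%:R^-1 => //.
  by move=> x y Mx My xz yz; apply: contrapT => nQxy; apply: nxy; exists (x, y).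
have cv (p : H * H -> H) : (forall n, `|p (xy n) - z| < n.+1%:R^-1 :> R) ->
    p (xy n) @[n --> \oo] --> z.
  move=> pz; apply/cvgrPdist_lt => e e0.
  near=> n; rewrite distrC; apply: lt_trans (pz n) _.
  by near: n; exact: near_infty_natSinv_lt (PosNum e0).
pose M' := (z |` range (fst \o xy)) `|` (z |` range (snd \o xy)).
have M'M : M' `<=` M.
  by move=> _ [[->|[n _ <-]]|[->|[n _ <-]]] //=; have [] := xyP n.
have wM' : weakly_compact M'.
  apply: (@compactU (weak H)); apply: weakly_compact_cvg_seq; apply: cv => n;
    by have [] := xyP n.
(* The constant [k] valid on the two sequences contradicts the choice of the pair with index [k]. *)
have [k Qk] := QM _ M'M wM'.
have [_ _ _ _] := xyP k; apply; apply: Qk.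
  by left; right; exists k.
by right; right; exists k.
Unshelve. all: by end_near. Qed.

(** * The du Bois-Reymond lemma *)

Section du_bois_reymond.
Context {R : realType}.
Notation mu := (@lebesgue_measure R).
Variables (B B' : R -> R).
Hypotheses (Bn : forall n, ndiff n B) (dB : forall x : R, is_derive x (1 : R) B (B' x))
  (cB' : continuous B')
  (hB : forall x, [/\ 0 <= B x <= 1, x <= 0 -> B x = 0, 1 <= x -> B x = 1,
     0 <= B' x & B' x != 0 -> 0 < x < 1]).

(* [st s d] rises smoothly from 0 to 1 on [s, s + d]. *)
Let arg (s d r : R) := d^-1 * r + - (d^-1 * s).
Let st s d r := B (arg s d r).
Let dst s d r := d^-1 * B' (arg s d r).

Let argE s d r : arg s d r = (r - s) / d.
Proof. by rewrite /arg -mulrBr mulrC. Qed.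

Let st_ndiff n s d : ndiff n (st s d).
Proof. exact: ndiff_affine. Qed.

Let darg s d (r : R) : is_derive r (1 : R) (arg s d) d^-1.
Proof.
have := is_deriveD (is_deriveZ d^-1 (is_derive_id r (1:R)))
  (is_derive_cst (- (d^-1 * s)) r (1:R)).
by rewrite addr0 [_ *: _]mulr1.
Qed.

Let st_derive s d (r : R) : is_derive r (1 : R) (st s d) (dst s d r).
Proof.
rewrite /dst mulrC.
exact: (@is_derive1_comp _ B (arg s d) r _ _ (dB (arg s d r)) (darg s d r)).
Qed.

Let st0 (s d r : R) : 0 < d -> r <= s -> st s d r = 0.
Proof.
move=> d0 rs; have [_ h _ _ _] := hB (arg s d r); apply: h.
by rewrite argE ler_pdivrMr// mul0r subr_le0.
Qed.

Let st1 (s d r : R) : 0 < d -> s + d <= r -> st s d r = 1.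
Proof.
move=> d0 rs; have [_ _ h _ _] := hB (arg s d r); apply: h.
by rewrite argE ler_pdivlMr// mul1r lerBrDl.
Qed.

Let dst_ge0 (s d r : R) : 0 < d -> 0 <= dst s d r.
Proof.
by move=> d0; have [_ _ _ h _] := hB (arg s d r); apply: mulr_ge0 => //; rewrite invr_ge0 ltW.
Qed.

Let dst_supp (s d r : R) : 0 < d -> dst s d r != 0 -> s <= r <= s + d.
Proof.
move=> d0; rewrite mulf_eq0 negb_or => /andP[_ h0].
have [_ _ _ _ /(_ h0)] := hB (arg s d r).
rewrite argE ltr_pdivrMr// mul1r pmulr_lgt0 ?invr_gt0// subr_gt0 ltrBlDl.
by move=> /andP[/ltW -> /ltW ->].
Qed.

Let dst_continuous s d : continuous (dst s d).
Proof.
move=> r; apply: cvgM; first exact: cvg_cst.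
apply: (@continuous_comp _ _ _ (arg s d) B'); last exact: cB'.
apply/differentiable_continuous/derivable1_diffP; by have [] := darg s d r.
Qed.

Let continuous_integrable (S : R) (g : R -> R) :
  {within `[0, S], continuous g} -> mu.-integrable `[0, S] (EFin \o g).
Proof. by apply: continuous_compact_integrable; exact: segment_compact. Qed.

Let dst_integral (s d S : R) : 0 < S -> 0 < d -> 0 <= s -> s + d <= S ->
  \int[mu]_(r in `[0, S]) dst s d r = 1.
Proof.
move=> S0 d0 s0 sS; rewrite /Rintegral.
rewrite (@continuous_FTC2 _ _ (st s d))//.
- by rewrite st1// st0//= subr0.
- exact/continuous_subspaceT/dst_continuous.
- have cst r : st s d r @[r --> r] --> st s d r.
    by apply/differentiable_continuous/derivable1_diffP; have [] := st_derive s d r.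
  split; first by move=> r _; have [] := st_derive s d r.
    exact/cvg_at_right_filter/cst.
  exact/cvg_at_left_filter/cst.
- by move=> r _; rewrite derive1E; have [_ ->] := st_derive s d r.
Qed.

(** [dst s d] is a nonnegative weight of total mass one carried by [s, s + d], so the weighted mean
    of [y] deviates from [y s] by at most the oscillation there. *)
Let step_average (S : R) (y : R -> R) (s d e : R) : 0 < S -> 0 < d -> 0 <= s -> s + d <= S ->
  {within `[0, S], continuous y} ->
  (forall r, s <= r <= s + d -> `|y r - y s| <= e) ->
  `| \int[mu]_(r in `[0, S]) (dst s d r * y r) - y s | <= e.
Proof.
move=> S0 d0 s0 sS cy ye.
have cd : {within `[0, S], continuous (dst s d)}.
  exact/continuous_subspaceT/dst_continuous.
have i1 : mu.-integrable `[0, S] (EFin \o (fun r => dst s d r * y r)).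
  by apply: continuous_integrable => r; exact: cvgM (cd r) (cy r).
have i2 : mu.-integrable `[0, S] (EFin \o (fun r => dst s d r)).
  exact: continuous_integrable.
have i3 : mu.-integrable `[0, S] (EFin \o (fun r => dst s d r * y s)).
  by apply: continuous_integrable => r; apply: cvgM (cd r) _; exact: cvg_cst.
have i4 : mu.-integrable `[0, S] (EFin \o (fun r => dst s d r * e)).
  by apply: continuous_integrable => r; apply: cvgM (cd r) _; exact: cvg_cst.
have i5 : mu.-integrable `[0, S] (EFin \o (fun r => dst s d r * y r - dst s d r * y s)).
  apply: continuous_integrable => r; apply: cvgB; first exact: cvgM (cd r) (cy r).
  by apply: cvgM (cd r) _; exact: cvg_cst.
rewrite -[X in _ - X]mul1r -(dst_integral S0 d0 s0 sS) -RintegralZr// -RintegralB//.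
apply: le_trans (le_normr_Rintegral _ i5) _ => //.
rewrite -[e]mul1r -(dst_integral S0 d0 s0 sS) -RintegralZr//.
apply: le_Rintegral => //; first exact: integrable_norm i5.
move=> r _ /=; rewrite -mulrBr normrM ger0_norm ?dst_ge0//.
have [->|/(dst_supp d0) h] := eqVneq (dst s d r) 0; first by rewrite !mul0r.
by rewrite ler_wpM2l ?dst_ge0// ye.
Qed.

Let test_step (S s t d : R) : 0 < d -> 0 < s -> s < t -> t + d < S ->
  test_function S (fun r => st s d r + -1 * st t d r).
Proof.
move=> d0 s0 st_ tS; split.
  apply: ndiff_derive1n => n; apply: ndiffD; first exact: st_ndiff.
  by apply: ndiffZ; exact: st_ndiff.
exists s, (t + d); split => // r; apply: contraNT.
rewrite in_itv/= negb_and -!ltNge => /orP[rs|rt].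
  by rewrite !st0 ?mulr0 ?addr0//; lra.
by rewrite !st1 ?mulr1 ?subrr//; lra.
Qed.
Let test_step_derive s t d (r : R) :
  derive1 (fun r => st s d r + -1 * st t d r) r = dst s d r - dst t d r.
Proof.
have h : is_derive r (1 : R) (fun r => st s d r + -1 * st t d r) (dst s d r - dst t d r).
  apply: is_derive_eq (is_deriveD (st_derive s d r) (is_deriveZ (-1 : R) (st_derive t d r))) _.
  by rewrite scaleN1r.
by rewrite derive1E; have [_ ->] := h.
Qed.

Let st_itv s d r : 0 <= st s d r <= 1.
Proof. by have [] := hB (arg s d r). Qed.

Let st_continuous s d : continuous (st s d).
Proof.
by move=> r; apply/differentiable_continuous/derivable1_diffP; have [] := st_derive s d r.
Qed.

(** The difference of the two steps equals the indicator of [s, t] outside [s, s + d] and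
    [t, t + d]. On these two intervals, of total measure at most 2 d, it is off by at most one. *)
Let step_integral (q : R -> R) (s t d d0 e : R) : mu.-integrable setT (EFin \o q) ->
  (forall A, measurable A -> (mu A < d0%:E)%E -> \int[mu]_(r in A) `|q r| < e) ->
  s < t -> 0 < d -> 2 * d < d0 ->
  `| \int[mu]_r ((st s d r + -1 * st t d r) * q r) - \int[mu]_(r in `[s, t]) q r| <= e.
Proof.
move=> iq qe st_ dp dd0.
pose phi r := st s d r + -1 * st t d r.
pose A : set R := `[s, s + d] `|` `[t, t + d].
have mA : measurable A by apply: measurableU.
have muA : (mu A < d0%:E)%E.
  have mud x : mu `[x, x + d] = d%:E.
    by rewrite lebesgue_measure_itv/= lte_fin ltrDl dp -EFinB addrAC subrr add0r.
  have : (mu `[s, (s + d)%R] + mu `[t, (t + d)%R] < d0%:E)%E.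
    by rewrite !mud -EFinD lte_fin; apply: le_lt_trans dd0; lra.
  by apply: le_lt_trans; exact: measureU2.
have mphi : measurable_fun setT phi.
  apply: continuous_measurable_fun => r; apply: cvgD; first exact: st_continuous.
  by apply: cvgM; [exact: cvg_cst|exact: st_continuous].
have mq : measurable_fun setT q by apply/measurable_EFinP; exact: measurable_int iq.
have iphiq : mu.-integrable setT (EFin \o (fun r => phi r * q r)).
  apply: le_integrable iq => //.
    by apply/measurable_EFinP; exact: measurable_funM.
  move=> r _ /=; rewrite lee_fin normrM ler_piMl// ler_norml.
  by rewrite /phi; have := st_itv s d r; have := st_itv t d r; lra.
have iqst : mu.-integrable setT (EFin \o (q \_ `[s, t])).
  rewrite -restrict_EFin; apply/integrable_restrict => //; rewrite setTI.
  exact: integrableS iq.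
have iqA : mu.-integrable setT (EFin \o ((Num.norm \o q) \_ A)).
  rewrite -restrict_EFin; apply/integrable_restrict => //; rewrite setTI.
  by apply: integrable_norm; exact: integrableS iq.
rewrite [X in _ - X]Rintegral_mkcond -RintegralB//.
have idiff : mu.-integrable setT (EFin \o (fun r => phi r * q r - (q \_ `[s, t]) r)).
  by have := integrableB measurableT iphiq iqst.
apply: le_trans (le_normr_Rintegral _ idiff) _ => //.
apply: le_trans (ltW (qe A mA muA)).
rewrite [leRHS]Rintegral_mkcond; apply: le_Rintegral => //.
  exact: integrable_norm.
move=> r _ /=; rewrite !patchE.
have [/set_mem Ar|/negP nA] := boolP (r \in A).
  rewrite (_ : (if _ then q r else 0) = (s <= r <= t)%R%:R * q r); last first.
    by rewrite mem_setE in_itv/=; case: ifP => _; rewrite ?mul1r ?mul0r.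
  rewrite -mulrBl normrM ler_piMl// ler_norml /phi.
  have := st_itv s d r; have := st_itv t d r.
  have [rt|rt] := leP r t; last by rewrite andbF /=; lra.
  by rewrite (st0 (s := t))//; case: (s <= r) => /=; lra.
rewrite mem_setE in_itv/=.
have [rs|rs] := ltP r s.
  by rewrite /phi !st0/= ?mulr0 ?addr0 ?mul0r ?subr0 ?normr0//; lra.
have rsd : s + d < r.
  rewrite ltNge; apply/negP => h; apply: nA; rewrite inE; left.
  by rewrite /= in_itv/= rs.
have [rt|rt] := leP r t.
  by rewrite /phi st1 ?st0 ?mulr0 ?addr0 ?mul1r ?subrr ?normr0// ltW.
have rtd : t + d < r.
  rewrite ltNge; apply/negP => h; apply: nA; rewrite inE; right.
  by rewrite /= in_itv/= ltW.
by rewrite /phi !st1 ?mulr1 ?subrr ?mul0r ?subr0 ?normr0// ltW.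
Qed.

(** The test function is a smoothed indicator of [s, t]. Its derivative averages [y] just after [s]
    minus [y] just after [t], and the right-hand side integrates [q] over nearly [s, t]. Each of the
    three errors is at most e / 3. *)
Lemma du_bois_reymond_step (S : R) (y q : R -> R) :
  {within `[0, S], continuous y} -> mu.-integrable setT (EFin \o q) ->
  (forall phi, test_function S phi ->
    \int[mu]_(r in `[0, S]) (derive1 phi r * y r) = - \int[mu]_r (phi r * q r)) ->
  forall s t, 0 < s -> s < t -> t < S -> y t - y s = \int[mu]_(r in `[s, t]) q r.
Proof.
move=> cy iq H s t s0 st_ tS.
have S0 : 0 < S by lra.
apply/eqP; rewrite -subr_eq0 -normr_le0; apply/ler_addgt0Pr => e e0; rewrite add0r.
have e4 : 0 < e / 3 by lra.
have yc x : 0 < x -> x < S -> exists2 d : R, 0 < d & forall r, x <= r <= x + d -> `|y r - y x| <= e / 3.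
  move=> x0 xS.
  have xc : {for x, continuous y}.
    by apply: (within_continuous_continuous S0 cy); rewrite in_itv/= x0 xS.
  have /cvgrPdist_le/(_ _ e4)[d /= d0 hd] := xc.
  exists (d / 2); first lra.
  move=> r rx; rewrite distrC; apply: hd; rewrite /= ltr_distl; lra.
have [d1 d10 hd1] := yc s s0 (lt_trans st_ tS).
have [d2 d20 hd2] := yc t (lt_trans s0 st_) tS.
have [d0 [d00 hd0]] := integral_normr_continuous iq e4.
(* [d1] and [d2] control the oscillation of [y] after [s] and [t], [d0 / 4] ensures 2 d < d0, and
   [(S - t) / 2] keeps the support of the test function inside ]0, S[. *)
pose d := Num.min (Num.min d1 d2) (Num.min (d0 / 4) ((S - t) / 2)).
have dp : 0 < d by rewrite !lt_min d10 d20; lra.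
have [dd1 dd2 dd0 ddS] : [/\ d <= d1, d <= d2, d <= d0 / 4 & d <= (S - t) / 2].
  by split; rewrite !ge_min lexx ?orbT.
have ts : test_function S (fun r => st s d r + -1 * st t d r).
  by apply: test_step => //; lra.
have := H _ ts.
have h1 := @step_average S y s d (e / 3) S0 dp (ltW s0) ltac:(lra) cy ltac:(by move=> r ?; apply: hd1; lra).
have h2 := @step_average S y t d (e / 3) S0 dp ltac:(lra) ltac:(lra) cy ltac:(by move=> r ?; apply: hd2; lra).
have h3 := @step_integral q s t d d0 (e / 3) iq hd0 st_ dp ltac:(lra).
have cd x : {within `[0, S], continuous (dst x d)}.
  exact/continuous_subspaceT/dst_continuous.
have idy x : mu.-integrable `[0, S] (EFin \o (fun r => dst x d r * y r)).
  by apply: continuous_integrable => r; exact: cvgM (cd x r) (cy r).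
under eq_Rintegral do rewrite test_step_derive mulrBl.
rewrite RintegralB// => h4.
move: h1 h2 h3 h4; rewrite !ler_norml.
set a := Rintegral _ _ _; set b := Rintegral _ _ _; set c := Rintegral _ _ _.
set f := Rintegral _ _ _; lra.
Qed.
End du_bois_reymond.

Lemma du_bois_reymond (R : realType) (S : R) (y q : R -> R) :
  {within `[0, S], continuous y} ->
  lebesgue_measure.-integrable setT (EFin \o q) ->
  (forall phi, test_function S phi ->
    \int[lebesgue_measure]_(r in `[0, S]) (derive1 phi r * y r) =
    - \int[lebesgue_measure]_r (phi r * q r)) ->
  forall s t, 0 < s -> s < t -> t < S ->
    y t - y s = \int[lebesgue_measure]_(r in `[s, t]) q r.
Proof.
have [B [B' [Bn dB cB' hB]]] := @smooth_step R.
exact: du_bois_reymond_step Bn dB cB' hB S y q.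
Qed.

(** * Measurability and Bochner integrals *)

(** Finitely many almost everywhere statements become one measurable set on which all of them hold
    at every point. *)
Definition full_set (R : realType) (S : R) (E : set (measurableTypeR R)) : Prop :=
  [/\ measurable E, E `<=` `[0, S]%classic
    & lebesgue_measure (`[0, S]%classic `\` E) = 0%E].

Section full_set.
Context {R : realType}.
Notation mu := (@lebesgue_measure R).
Implicit Types (S : R) (E : set (measurableTypeR R)).

Lemma full_setI S E F : full_set S E -> full_set S F -> full_set S (E `&` F).
Proof.
move=> [mE ES E0] [mF FS F0]; split.
- exact: measurableI.
- by move=> t [/ES].
- rewrite setDIr; apply/eqP; rewrite -measure_le0.
  have : (mu (`[0%R, S]%classic `\` E) + mu (`[0%R, S]%classic `\` F) <= 0)%E.
    by rewrite E0 F0 adde0.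
  by apply: le_trans; apply: measureU2; exact: measurableD.
Qed.

Lemma aeI_full S (Q : R -> Prop) : aeI S Q ->
  exists2 E : set (measurableTypeR R), full_set S E & forall t, E t -> Q t.
Proof.
move=> [N [mN N0 QN]]; exists (`[0, S]%classic `\` N).
  split; first exact: measurableD.
    by move=> t [].
  apply/eqP; rewrite -measure_le0 -N0; apply: le_measure; rewrite ?inE//.
    by apply: measurableD => //; exact: measurableD.
  by move=> t [St /not_andP[//|/contrapT]].
by move=> t [St Nt]; apply: contrapT => nQ; apply: Nt; apply: QN => h; exact/nQ/h.
Qed.

Lemma full_aeI S E (Q : R -> Prop) : full_set S E ->
  (forall t, E t -> Q t) -> aeI S Q.
Proof.
move=> [mE ES E0] EQ; exists (`[0, S]%classic `\` E); split => //.
  exact: measurableD.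
move=> t /= /not_implyP[St nQ]; split => // /EQ.
exact: nQ.
Qed.

(** Otherwise ]a, b[ would lie in a null set. This supplies partition nodes at which the equations
    hold. *)
Lemma full_dense S E a b : full_set S E -> 0 <= a -> a < b -> b <= S ->
  exists2 t, E t & a < t < b.
Proof.
move=> [mE ES E0] a0 ab bS; apply: contrapT => h.
have : (mu `]a, b[ <= mu (`[0%R, S]%classic `\` E))%E.
  apply: le_measure; rewrite ?inE//; first exact: measurableD.
  move=> t /=; rewrite in_itv/= => /andP[at_ tb]; split.
    by rewrite /= in_itv/=; apply/andP; split; lra.
  by move=> Et; apply: h; exists t => //; rewrite at_.
by rewrite E0 lebesgue_measure_itv/= lte_fin ab -EFinB lee_fin leNgt subr_gt0 ab.
Qed.

Lemma simple_fun_comp (X : normedModType R) (s : R -> X) (k : X -> R) :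
  simple_fun s -> measurable_fun setT (k \o s).
Proof.
move=> [fs ms] _ Y mY; rewrite setTI comp_preimage.
have -> : s @^-1` (k @^-1` Y) = \bigcup_(x in range s `&` k @^-1` Y) s @^-1` [set x].
  rewrite eqEsubset; split => [t /= Yt|t [x [_ Yx] /= ->]//].
  by exists (s t) => //; split => //; exists t.
apply: fin_bigcup_measurable => [|x _]; last exact: ms.
exact: finite_setIl.
Qed.

(** Measurability of a vector-valued function is expressed through continuous real functions of it;
    the norm and [ip^~ h] are the ones used. On [E] the simple approximants converge at every
    point. *)
Lemma strongly_measurable_full (X : normedModType R) S (f : R -> X) :
  strongly_measurable S f -> exists2 E, full_set S E &
  forall k : X -> R, continuous k -> measurable_fun E (k \o f).
Proof.
move=> [s [ss /aeI_full[E fE sE]]]; exists E => // k ck.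
have [mE _ _] := fE.
apply: (@measurable_fun_cvg _ _ _ _ (fun n => k \o s n)) => [n|t Et].
  by apply: measurable_funTS; exact: simple_fun_comp.
exact: (cvg_comp _ _ (sE t Et) (ck (f t))).
Qed.

(* The lower integral of a nonnegative function is monotone even without
   measurability, which the integrals in [bochner_integral] do not provide. *)
Lemma ge0_le_integral_nm (D : set (measurableTypeR R)) (f g : R -> \bar R) :
  (forall x, D x -> (0 <= f x)%E) -> (forall x, D x -> (f x <= g x)%E) ->
  (\int[mu]_(x in D) f x <= \int[mu]_(x in D) g x)%E.
Proof.
move=> f0 fg; have g0 x : D x -> (0 <= g x)%E by move=> Dx; exact: le_trans (f0 _ Dx) (fg _ Dx).
rewrite !ge0_integralE//; apply: le_ereal_sup => _ [h hf <-]; exists h => // x.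
apply: le_trans (hf x) _; rewrite !patchE; case: ifPn => // /set_mem; exact: fg.
Qed.
End full_set.

Section bochner.
Context {R : realType} {H : normedModType R} (ip : {dot H for idfun}).
Hypothesis hip : induces_norm ip.
Notation mu := (@lebesgue_measure R).

Lemma full_measureI (S : R) (E A : set (measurableTypeR R)) : full_set S E -> measurable A ->
  mu (`[0, S]%classic `&` A) = mu (E `&` A).
Proof.
move=> [mE ES E0] mA; apply/eqP; rewrite eq_le; apply/andP; split; last first.
  apply: le_measure; rewrite ?inE; [exact: measurableI|exact: measurableI|].
  by move=> t [/ES ? ?]; split.
have : (mu (E `&` A) + mu (`[0%R, S]%classic `\` E) <= mu (E `&` A))%E.
  by rewrite E0 adde0.
apply: le_trans; have : (mu ((E `&` A) `|` (`[0%R, S]%classic `\` E)) <=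
    mu (E `&` A) + mu (`[0%R, S]%classic `\` E))%E.
  by apply: measureU2; [exact: measurableI|exact: measurableD].
apply: le_trans; apply: le_measure; rewrite ?inE; first exact: measurableI.
  by apply: measurableU; [exact: measurableI|exact: measurableD].
move=> t [St At]; have [Et|nEt] := pselect (E t); first by left.
by right.
Qed.

Lemma full_measure_lty (S : R) (E : set (measurableTypeR R)) : full_set S E -> (mu E < +oo)%E.
Proof.
move=> [mE ES E0]; have : (mu `[0%R, S]%classic < +oo)%E.
  by rewrite lebesgue_measure_itv/= lte_fin; case: ifP => _; rewrite ?ltry.
by apply: le_lt_trans; apply: le_measure; rewrite ?inE.
Qed.

Lemma Rintegral_sum_indic (E : set (measurableTypeR R)) (I : Type) (r : seq I) (c : I -> R)
    (A : I -> set (measurableTypeR R)) : measurable E -> (mu E < +oo)%E ->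
  (forall i, measurable (A i)) ->
  mu.-integrable E (EFin \o (fun t => \sum_(i <- r) c i * \1_(A i) t)) /\
  \int[mu]_(t in E) (\sum_(i <- r) c i * \1_(A i) t) =
  \sum_(i <- r) c i * fine (mu (E `&` A i)).
Proof.
move=> mE Eoo mA.
have i1 i : mu.-integrable E (EFin \o \1_(A i)).
  apply: measurable_bounded_integrable => //.
  exists 1; split => // x x1 t _ /=; rewrite indicE ger0_norm//.
  by apply: le_trans (ltW x1); case: (_ \in _).
have i2 i : mu.-integrable E (EFin \o (fun t => c i * \1_(A i) t)).
  by have := integrableZl mE (c i) (i1 i).
elim: r => [|i r [IH1 IH2]].
  split; first by under eq_fun do rewrite big_nil; exact: integrable0.
  under eq_Rintegral do rewrite big_nil.
  by rewrite Rintegral_cst// mul0r big_nil.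
split.
  under eq_fun do rewrite big_cons.
  exact: (integrableD mE (i2 i) IH1).
under eq_Rintegral do rewrite big_cons.
rewrite RintegralD// IH2 big_cons RintegralZl//; congr (_ * _ + _).
by rewrite /Rintegral integral_indic// setIC.
Qed.

Lemma ip_suml (I : Type) (r : seq I) (x : I -> H) h :
  ip (\sum_(i <- r) x i) h = \sum_(i <- r) ip (x i) h.
Proof.
elim: r => [|i r IH]; last by rewrite !big_cons ipDl IH.
by rewrite !big_nil -(subrr (0:H)) ipBl subrr.
Qed.

Lemma ip_simple_integral (S : R) (E : set (measurableTypeR R)) (s : R -> H) h :
  full_set S E -> simple_fun s ->
  mu.-integrable E (EFin \o (fun t => ip (s t) h)) /\
  ip (simple_integral S s) h = \int[mu]_(t in E) ip (s t) h.
Proof.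
move=> fE [fs ms]; have [mE _ _] := fE.
have sE t : ip (s t) h = \sum_(x <- finmap.enum_fset (fset_set (range s))) ip x h * \1_(s @^-1` [set x]) t.
  rewrite (bigD1_seq (s t)) ?finmap.fset_uniq//=; last by rewrite in_fset_set// inE; exists t.
  rewrite indicE mem_set// mulr1 big1 ?addr0// => x xst.
  by rewrite indicE memNset ?mulr0//= => /eqP; rewrite eq_sym (negbTE xst).
have [i1 i2] := Rintegral_sum_indic (finmap.enum_fset (fset_set (range s))) (ip^~ h) mE
  (full_measure_lty fE) ms.
split; first by under eq_fun do rewrite sE.
under [RHS]eq_Rintegral do rewrite sE.
rewrite i2 /simple_integral fsbig_finite//= ip_suml.
apply: eq_bigr => x _; rewrite ipZl mulrC (full_measureI fE) //; exact: ms.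
Qed.

(** The functional (., h) commutes with the Bochner integral. It does so for simple functions, and
    the error for the approximants is at most |h| times the integral of |s_n - F|, which tends to
    zero. *)
Lemma bochner_ip (S : R) (E : set (measurableTypeR R)) (F : R -> H) (I h : H) (q : R -> R) :
  full_set S E -> bochner_integral S F I ->
  mu.-integrable setT (EFin \o q) ->
  (forall t, E t -> q t = ip (F t) h) -> (forall t, ~ E t -> q t = 0) ->
  ip I h = \int[mu]_t q t.
Proof.
move=> fE [_ [s [ss e0 sI]]] iq qE q0; have [mE ES _] := fE.
have iqE : mu.-integrable E (EFin \o q) by apply: integrableS iq.
have -> : \int[mu]_t q t = \int[mu]_(t in E) q t.
  rewrite [RHS]Rintegral_mkcond; apply: eq_Rintegral => t _.
  by rewrite patchE; case: ifPn => // /negP; rewrite inE => /q0.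
have c1 : ip (simple_integral S (s n)) h @[n --> \oo] --> ip I h.
  have ch : {for I, continuous (ip^~ h)} by exact: ip_continuous.
  by apply: continuous_cvg ch _; exact: sI.
suff c2 : ip (simple_integral S (s n)) h @[n --> \oo] --> \int[mu]_(t in E) q t.
  by have := cvg_unique _ c1 c2; apply.
have bound n : (`|ip (simple_integral S (s n)) h - \int[mu]_(t in E) q t|%:E <=
   (`|h| + 1)%:E * \int[mu]_(t in `[0%R, S]) `|s n t - F t|%:E)%E.
  have [i1 ->] := ip_simple_integral h fE (ss n).
  rewrite -RintegralB//.
  have i2 : mu.-integrable E (EFin \o (fun t => ip (s n t) h - q t)).
    exact: (integrableB mE i1 iqE).
  have hp : 0 < `|h| + 1 by rewrite ltr_wpDl.
  rewrite EFin_normr_Rintegral//.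
  apply: le_trans (le_abse_integral _ _ _) _ => //; first exact: measurable_int i2.
  (* Measurability of |s_n - F| is not given, so the factor is moved to the integrable side and
     cancelled. Using |h| + 1 instead of |h| makes it invertible. *)
  have -> : (\int[mu]_(t in E) `|(ip (s n t) h - q t)%:E| =
    (`|h| + 1)%:E * \int[mu]_(t in E) ((`|h| + 1)^-1 * `|ip (s n t) h - q t|)%:E)%E.
    rewrite -integralZl//; last exact: (integrableZl mE (`|h| + 1)^-1 (integrable_norm i2)).
    by apply: eq_integral => t _; rewrite -EFinM mulrA divff ?gt_eqF// mul1r.
  rewrite lee_pmul2l//.
  rewrite integral_mkcond [leRHS]integral_mkcond; apply: ge0_le_integral_nm => t _.
    by rewrite patchE; case: ifP => // _; rewrite lee_fin mulr_ge0// invr_ge0 ltW.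
  rewrite !patchE; case: ifPn => [/set_mem Et|_]; last first.
    by case: ifP => // _; rewrite lee_fin.
  rewrite mem_set; last exact: ES.
  rewrite lee_fin ler_pdivrMl// qE// -ipBl; apply: le_trans (le_ip hip _ _) _.
  by rewrite mulrC ler_wpM2r// lerDl.
have : (`|ip (simple_integral S (s n)) h - \int[mu]_(t in E) q t|%:E)%E @[n --> \oo] --> 0%E.
  apply: (@squeeze_cvge _ _ _ _ (cst 0%E) _ (fun n => (`|h| + 1)%:E * \int[mu]_(t in `[0%R, S]) `|s n t - F t|%:E)%E).
  - by near=> n; rewrite bound andbT lee_fin.
  - exact: cvg_cst.
  - by rewrite -(mule0 (`|h| + 1)%:E); apply: cvgeZl.
move=> /fine_cvg /norm_cvg0 c0.
rewrite -[X in _ --> X]add0r.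
under eq_fun do rewrite -[ip _ h](subrK (\int[mu]_(t in E) q t)).
by apply: cvgD c0 _; exact: cvg_cst.
Unshelve. all: by end_near. Qed.
End bochner.

(** * The fundamental theorem for weak derivatives *)

Section ftc.
Context {R : realType} {H : normedModType R} (ip : {dot H for idfun}).
Hypothesis hip : induces_norm ip.
Notation mu := (@lebesgue_measure R).

(** Pairing the two Bochner integrals of the weak derivative with [h] gives the scalar identity
    required by [du_bois_reymond], with y = (xc, h) and q = (w, h) extended by zero. *)
Lemma weak_derivative_ftc (S : R) (E : set (measurableTypeR R))
    (x w xc : R -> H) (h : H) (q : R -> R) :
  full_set S E -> (forall t, E t -> xc t = x t) ->
  {within `[0, S], continuous xc} -> weak_derivative S x w ->
  mu.-integrable setT (EFin \o q) ->
  (forall t, E t -> q t = ip (w t) h) -> (forall t, ~ E t -> q t = 0) ->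
  forall s t, 0 < s -> s < t -> t < S ->
    ip (xc t - xc s) h = \int[mu]_(r in `[s, t]) q r.
Proof.
move=> fE xcE cxc wd iq qE q0 s t s0 st tS.
have [mE ES E0] := fE.
have cy : {within `[0, S], continuous (fun r => ip (xc r) h)}.
  move=> r; have ch : {for xc r, continuous (ip^~ h)} by exact: ip_continuous.
  apply: (@continuous_cvg _ _ _ _ _ xc (ip^~ h) (xc r) ch); last exact: (cxc r).
  exact: nbhs_subspace_filter.
rewrite ipBl; apply: (du_bois_reymond cy iq) => // phi tphi.
have [I [b1 b2]] := wd phi tphi.
have [phiD _] := tphi.
have cphi : continuous phi.
  by move=> r; apply/differentiable_continuous/derivable1_diffP; exact: (phiD 0%N).
have cphi' : continuous (derive1 phi).
  by move=> r; apply/differentiable_continuous/derivable1_diffP; exact: (phiD 1%N).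
(* [x] is replaced by its continuous representative, equal to it on [E], so that the integrand is
   continuous on [0, S] and hence integrable. *)
pose q1 r := derive1 phi r * ip (xc r) h.
have iq1 : mu.-integrable `[0, S] (EFin \o q1).
  apply: continuous_compact_integrable; first exact: segment_compact.
  by move=> r; apply: cvgM (cy r); exact: (continuous_subspaceT cphi').
have iq1E : mu.-integrable setT (EFin \o (q1 \_ E)).
  rewrite -restrict_EFin; apply/integrable_restrict => //; rewrite setTI.
  exact: integrableS iq1.
have iq2 : mu.-integrable setT (EFin \o (fun r => phi r * q r)).
  have iqS : mu.-integrable `[0, S] (EFin \o q) by apply: integrableS iq.
  have := @integrableMr _ _ _ mu `[0, S] (measurable_itv _) phi (EFin \o q).
  have bphi : [bounded phi r | r in `[0, S]%classic].
    have /compact_bounded[M0 [_ mrt]] :=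
      continuous_compact (continuous_subspaceT cphi) (@segment_compact _ 0 S).
    by exists M0; split; rewrite ?num_real // => ? ? r rS; apply: mrt => //; exists r.
  move=> /(_ _ bphi iqS) hS.
  have {}hS : mu.-integrable `[0, S] (EFin \o (fun r => phi r * q r)).
    apply: hS; apply: measurable_funTS; exact: continuous_measurable_fun.
  have -> : (fun r => phi r * q r) = (fun r => phi r * q r) \_ `[0, S]%classic.
    apply/funext => r; rewrite patchE; case: ifPn => // /negP; rewrite inE => nr.
    by rewrite q0 ?mulr0// => /ES.
  by rewrite -restrict_EFin; apply/integrable_restrict => //; rewrite setTI.
have e1 : ip I h = \int[mu]_r (q1 \_ E) r.
  apply: (bochner_ip hip fE b1 iq1E) => r Er; last by rewrite patchE memNset.
  by rewrite patchE mem_set// /q1 ipZl xcE.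
have e2 : ip (- I) h = \int[mu]_r (phi r * q r).
  apply: (bochner_ip hip fE b2 iq2) => r Er; first by rewrite ipZl qE.
  by rewrite q0// mulr0.
rewrite -e2 ipNl opprK e1 -Rintegral_mkcond /Rintegral.
congr fine; rewrite (negligible_integral _ _ iq1 E0)//; last exact: measurableD.
by rewrite setDD setIidr.
Qed.
End ftc.

(** * The difference of two solutions *)

Section pointwise.
Context {R : realType} {V H : normedModType R} (ip : {dot H for idfun})
  (j : {linear V -> H}).
Hypothesis hip : induces_norm ip.
Variables (T : R) (a : R -> {symmetric V}) (beta mu L : R)
  (A A1 A2 : R -> V -> dual V) (M : set H) (TM : H -> set H) (P : H -> H -> H).
Hypotheses (ha : form_assumptions T a beta mu L) (hA : represents_form T a A)
  (hA3 : assumption_A3 j M TM P)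
  (hA4a : forall (t : R) u v, t \in `[0, T] ->
        pairing (A t u) v = pairing (A1 t u) v + pairing (A2 t u) v)
  (hA4b : forall (t : R) u v z, t \in `[0, T] -> M (j u) ->
        j z = P (j u) (j v) -> pairing (A1 t u) v = pairing (A1 t u) z).

(** The test vector is [P (j x) (j v)], which is in V by (A3)(b). (A4)(a) replaces it by [v] in A_1,
    so the full form a(x, v) appears, and the correction is A_2 applied to the normal part of
    [j v]. *)
Lemma solution_tested (t : R) (x : V) (w f g : H) (v : V) :
  t \in `[0, T] -> M (j x) ->
  (forall v, TM (j x) (j v) -> ip w (j v) + a t x v = ip f (j v)) ->
  (forall v, pairing (A2 t x) v = ip g (j v)) ->
  ip w (P (j x) (j v)) =
  ip f (P (j x) (j v)) - a t x v + ip g (j v - P (j x) (j v)).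
Proof.
move=> tT Mx eqx gx.
have [TP [z _ jz]] : TM (j x) (P (j x) (j v)) /\ range j (P (j x) (j v)).
  by apply: hA3.2 => //; eexists.
have := eqx z; rewrite jz => /(_ TP).
rewrite !hA// !hA4a// -(hA4b tT Mx jz) !gx jz ipBr => <-.
by rewrite opprD; move: (ip w _) (pairing _ _) (ip g _) (ip g _) => *; ring.
Qed.

Variables (x y : V) (wx wy f gx gy : H) (t c : R).
Let d := j x - j y.
Hypotheses (tT : t \in `[0, T]) (Mx : M (j x)) (My : M (j y))
  (eqx : forall v, TM (j x) (j v) -> ip wx (j v) + a t x v = ip f (j v))
  (eqy : forall v, TM (j y) (j v) -> ip wy (j v) + a t y v = ip f (j v))
  (hgx : forall v, pairing (A2 t x) v = ip gx (j v))
  (hgy : forall v, pairing (A2 t y) v = ip gy (j v))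
  (Pxy : `|P (j x) d - P (j y) d| <= c * `|d| ^+ 2)
  (Px : `|d - P (j x) d| <= c * `|d| ^+ 2)
  (Py : `|d - P (j y) d| <= c * `|d| ^+ 2).

Lemma projected_difference_le :
  ip wx (P (j x) d) - ip wy (P (j y) d) <=
  c * (`|f| + `|gx| + `|gy|) * `|d| ^+ 2.
Proof.
have dE : d = j (x - y) by rewrite linearB.
rewrite dE (solution_tested (x - y) tT Mx eqx hgx).
rewrite (solution_tested (x - y) tT My eqy hgy) -dE.
have [[_ mu0 _] _ hmu _] := ha.
(* The two form terms combine to a(x - y, x - y), which is nonnegative by coercivity and has the
   sign that allows it to be dropped. *)
have a0 : 0 <= a t x (x - y) - a t y (x - y).
  rewrite -linearBl; apply: le_trans (hmu t (x - y) tT).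
  by rewrite mulr_ge0 ?exprn_ge0// ltW.
have h1 : ip f (P (j x) d) - ip f (P (j y) d) <= `|f| * (c * `|d| ^+ 2).
  by rewrite -ipBr; apply: le_trans (ip_le hip _ _) _; rewrite ler_wpM2l.
have h2 : ip gx (d - P (j x) d) <= `|gx| * (c * `|d| ^+ 2).
  by apply: le_trans (ip_le hip _ _) _; rewrite ler_wpM2l.
have h3 : - ip gy (d - P (j y) d) <= `|gy| * (c * `|d| ^+ 2).
  by rewrite -ipNl -(normrN gy); apply: le_trans (ip_le hip _ _) _; rewrite ler_wpM2l.
move: a0 h1 h2 h3.
move: (a t x _) (a t y _) (ip f _) (ip f _) (ip gx _) (ip gy _) => a1 a2 f1 f2 g1 g2.
move: `|f| `|gx| `|gy| (`|d| ^+ 2) => nf ngx ngy nd; lra.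
Qed.
End pointwise.

(** * Removing a quadratic term by fine partitions *)

Section partition.
Context {R : realType}.
Notation mu := (@lebesgue_measure R).
Variable G : R -> R.
Hypotheses (iG : mu.-integrable setT (EFin \o G)) (G0 : forall t, 0 <= G t).

Lemma Rintegral_split (s m t : R) : s <= m -> m <= t ->
  \int[mu]_(r in `[s, t]) G r =
  \int[mu]_(r in `[s, m]) G r + \int[mu]_(r in `[m, t]) G r.
Proof.
move=> sm mt; apply/eqP; rewrite addrC -subr_eq; apply/eqP.
rewrite Rintegral_itvB ?bnd_simp//; last by apply: integrableS iG.
by rewrite Rintegral_itv_obnd_cbnd//; apply: integrableS iG.
Qed.

Lemma Rintegral_itv_small (e : R) : 0 < e ->
  exists2 d, 0 < d & forall s t, t - s < d -> \int[mu]_(r in `[s, t]) G r < e.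
Proof.
move=> e0; have [d [d0 hd]] := integral_normr_continuous iG e0.
exists d => // s t std.
under eq_Rintegral do rewrite -[G _]ger0_norm//.
have md : (mu `[s, t] < d%:E)%E.
  by rewrite lebesgue_measure_itv/=; case: ifP => _; rewrite -?EFinB lte_fin.
exact: hd md.
Qed.

Lemma Rintegral_itv_ge0 (s t : R) : 0 <= \int[mu]_(r in `[s, t]) G r.
Proof. by apply: Rintegral_ge0 => r _. Qed.

(** On a short cell, K I is at most e, so the increment is at most (c + e) I; this bound is additive
    over cells because I is. Then e tends to zero. *)
Lemma quadratic_increment (Psi : R -> R) (D : set R) (lo hi c K : R) :
  0 <= K ->
  (forall a b, lo < a -> a < b -> b < hi -> exists2 m, D m & a < m < b) ->
  (forall s t, D s -> D t -> lo < s -> s < t -> t < hi ->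
    Psi t - Psi s <= c * \int[mu]_(r in `[s, t]) G r +
      K * (\int[mu]_(r in `[s, t]) G r) ^+ 2) ->
  forall s t, D s -> D t -> lo < s -> s < t -> t < hi ->
    Psi t - Psi s <= c * \int[mu]_(r in `[s, t]) G r.
Proof.
move=> K0 dD hD s t Ds Dt los st thi.
pose I s t := \int[mu]_(r in `[s, t]) G r.
suff claim e : 0 < e -> Psi t - Psi s <= (c + e) * I s t.
  apply/ler_addgt0Pr => e e0.
  have I0 : 0 <= I s t := Rintegral_itv_ge0 s t.
  have I1 : 0 < I s t + 1 by rewrite ltr_wpDl.
  (* With this choice the total error e I / (I + 1) is at most e. *)
  apply: le_trans (claim (e / (I s t + 1)) _) _; first exact: divr_gt0.
  rewrite mulrDl lerD2l mulrAC ler_pdivrMr// ler_wpM2l//; first exact: ltW.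
  by rewrite lerDl.
move=> e0.
have K1 : 0 < K + 1 by rewrite ltr_wpDl.
have [d d0 hd] := Rintegral_itv_small (divr_gt0 e0 K1).
have short s' t' : D s' -> D t' -> lo < s' -> s' < t' -> t' < hi -> t' - s' < d ->
    Psi t' - Psi s' <= (c + e) * I s' t'.
  move=> Ds' Dt' lo' st' hi' dst; apply: le_trans (hD _ _ Ds' Dt' lo' st' hi') _.
  rewrite mulrDl lerD2l expr2 mulrA ler_wpM2r ?Rintegral_itv_ge0//.
  have := hd _ _ dst; rewrite ltr_pdivlMr// => h; apply: le_trans (ltW h).
  by rewrite mulrDr mulr1 mulrC lerDl Rintegral_itv_ge0.
have [n nP] : exists n : nat, t - s <= n%:R * (d / 2).
  exists (Num.trunc ((t - s) / (d / 2))).+1.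
  by rewrite -ler_pdivrMr ?divr_gt0// ltW// truncnS_gt.
elim: n t Dt st thi nP => [|n IH] t' Dt' st' thi' nP.
  by move: nP; rewrite mul0r subr_le0 leNgt st'.
have [dst|dst] := ltP (t' - s) d; first exact: short.
(* A node in this window makes the last cell shorter than [d] and shortens the rest by at least d /
   2, which pays for one step of the induction. As t' - s >= d, the node lies to the right of
   [s]. *)
have [m Dm /andP[m1 m2]] : exists2 m, D m & t' - d < m < t' - d / 2.
  by apply: dD; lra.
have [sm|ms] := ltP s m.
  have := IH m Dm sm ltac:(lra); rewrite -natr1 in nP.
  move=> /(_ ltac:(lra)) h1.
  have := short m t' Dm Dt' ltac:(lra) ltac:(lra) thi' ltac:(lra) => h2.
  rewrite /I (@Rintegral_split s m t') ?mulrDr//; try lra.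
  by rewrite -/(I s m) -/(I m t'); lra.
by lra.
Qed.
End partition.

(** * The increment of the squared distance over one interval *)

Section increment.
Context {R : realType} {H : normedModType R} (ip : {dot H for idfun}).
Hypothesis hip : induces_norm ip.
Variables (P : H -> H -> H) (uc vc wu wv : R -> H) (E : set R) (G : R -> R)
  (I C k m s t : R).
Let d r := uc r - vc r.
Hypotheses (C0 : 0 <= C) (k0 : 0 <= k) (I0 : 0 <= I) (Es : E s) (Et : E t)
  (st : s < t) 
  (Plin : forall r, E r -> s <= r <= t ->
    [/\ forall x y, P (uc r) (x - y) = P (uc r) x - P (uc r) y,
        forall x y, P (vc r) (x - y) = P (vc r) x - P (vc r) y,
        forall x, `|P (uc r) x| <= `|x| & forall x, `|P (vc r) x| <= `|x|])
  (Pusym : forall x y, ip (P (uc s) x) y = ip x (P (uc s) y))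
  (Pvsym : forall x y, ip (P (vc s) x) y = ip x (P (vc s) y))
  (GE : forall r, E r -> s <= r <= t -> `|wu r| + `|wv r| <= G r)
  (uI : forall r, E r -> s <= r <= t -> `|uc r - uc s| <= I)
  (vI : forall r, E r -> s <= r <= t -> `|vc r - vc s| <= I)
  (ftc : forall h1 h2 c,
     (forall r, E r -> s <= r <= t -> ip (wu r) h1 - ip (wv r) h2 <= c * G r) ->
     ip (uc t - uc s) h1 - ip (vc t - vc s) h2 <= c * I)
  (Pulip : forall r, E r -> s <= r <= t ->
     forall h, `|P (uc s) h - P (uc r) h| <= k * `|uc r - uc s| * `|h|)
  (Pvlip : forall r, E r -> s <= r <= t ->
     forall h, `|P (vc s) h - P (vc r) h| <= k * `|vc r - vc s| * `|h|)
  (Pu2 : `|uc t - uc s - P (uc s) (uc t - uc s)| <= k * `|uc t - uc s| ^+ 2)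
  (Pv2 : `|vc t - vc s - P (vc s) (vc t - vc s)| <= k * `|vc t - vc s| ^+ 2)
  (d1 : forall r, E r -> s <= r <= t -> `|d r| <= 1)
  (main : forall r, E r -> s <= r <= t ->
     ip (wu r) (P (uc r) (d r)) - ip (wv r) (P (vc r) (d r)) <= C * m * G r).

(** The start is E(t) - E(s) = 2 (d(t) - d(s), d(s)) + |d(t) - d(s)|^2. Projections are frozen at
    [s], so that [ftc] applies with fixed vectors. Freezing contributes 2 (2 + k) I^2, the normal
    parts of the two increments 4 k I^2, and the last square 4 I^2, which makes 8 + 6 k. *)
Lemma increment_le :
  `|d t| ^+ 2 - `|d s| ^+ 2 <= 2 * C * m * I + (8 + 6 * k) * I ^+ 2.
Proof.
have dI r : E r -> s <= r <= t -> `|d s - d r| <= 2 * I.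
  move=> Er rst; have -> : d s - d r = (vc r - vc s) - (uc r - uc s).
    by rewrite /d !opprB addrACA [RHS]addrACA [uc s + _]addrC.
  apply: le_trans (ler_normB _ _) _.
  by have := uI Er rst; have := vI Er rst; lra.
(* The cost of passing from time [r] to [s]: 2 I for changing [d], and k I for changing the
   projection since |d(r)| <= 1. *)
have Pd (w : R -> H) (c : R -> H) : (forall r, E r -> s <= r <= t ->
     (forall x y, P (c r) (x - y) = P (c r) x - P (c r) y) /\ (forall x, `|P (c r) x| <= `|x|)) ->
   (forall r, E r -> s <= r <= t ->
     forall h, `|P (c s) h - P (c r) h| <= k * `|c r - c s| * `|h|) ->
   (forall r, E r -> s <= r <= t -> `|c r - c s| <= I) ->
   forall r, E r -> s <= r <= t ->
   `|ip (w r) (P (c s) (d s)) - ip (w r) (P (c r) (d r))| <= (2 + k) * I * `|w r|.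
  move=> cP clip cI r Er rst; rewrite -ipBr; apply: le_trans (le_ip hip _ _) _.
  rewrite mulrC ler_wpM2r//.
  have ss : s <= s <= t by rewrite lexx ltW.
  have -> : P (c s) (d s) - P (c r) (d r) = P (c s) (d s - d r) + (P (c s) (d r) - P (c r) (d r)).
    by rewrite ((cP s Es ss).1 (d s) (d r)) subrKA.
  apply: le_trans (ler_normD _ _) _; rewrite mulrDl lerD//.
    exact: le_trans ((cP s Es ss).2 _) (dI r Er rst).
  apply: le_trans (clip r Er rst _) _.
  rewrite -[k * I]mulr1 ler_pM// ?mulr_ge0//; last exact: d1.
  by rewrite ler_wpM2l// cI.
have h1 : ip (uc t - uc s) (P (uc s) (d s)) - ip (vc t - vc s) (P (vc s) (d s)) <=
    (C * m + (2 + k) * I) * I.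
  apply: ftc => r Er rst.
  have b1 := Pd wu uc (fun r Er rst => let: And4 a _ b _ := Plin Er rst in conj a b) Pulip uI r Er rst.
  have b2 := Pd wv vc (fun r Er rst => let: And4 _ a _ b := Plin Er rst in conj a b) Pvlip vI r Er rst.
  have b3 := main Er rst.
  have b4 : (2 + k) * I * (`|wu r| + `|wv r|) <= (2 + k) * I * G r.
    by rewrite ler_wpM2l ?GE// mulr_ge0// addr_ge0.
  move: b1 b2 b3 b4; rewrite !ler_norml; lra.
(* By symmetry the projection moves onto the increment, whose normal part is quadratically small by
   (A2). *)
have h2 (c : R -> H) : (forall x y, ip (P (c s) x) y = ip x (P (c s) y)) ->
   `|c t - c s - P (c s) (c t - c s)| <= k * `|c t - c s| ^+ 2 -> `|c t - c s| <= I ->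
   `|ip (c t - c s) (d s) - ip (c t - c s) (P (c s) (d s))| <= k * I ^+ 2.
  move=> sym c2 cI; rewrite -sym -ipBl; apply: le_trans (le_ip hip _ _) _.
  rewrite -[leRHS]mulr1 ler_pM//; last by apply: d1 => //; rewrite lexx ltW.
  by apply: le_trans c2 _; rewrite ler_wpM2l// ler_pXn2r ?nnegrE.
have tt : s <= t <= t by rewrite lexx ltW.
have e1 := h2 uc Pusym Pu2 (uI Et tt).
have e2 := h2 vc Pvsym Pv2 (vI Et tt).
have e3 : `|d s - d t| ^+ 2 <= (2 * I) ^+ 2.
  by rewrite ler_pXn2r ?nnegrE ?mulr_ge0//; exact: dI.
have e4 : `|d t| ^+ 2 - `|d s| ^+ 2 =
    2 * (ip (uc t - uc s) (d s) - ip (vc t - vc s) (d s)) + `|d s - d t| ^+ 2.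
  rewrite -!hip -ipBl.
  have -> : uc t - uc s - (vc t - vc s) = d t - d s.
    by rewrite /d !opprB addrACA [RHS]addrACA [- uc s + _]addrC.
  move: (d s) (d t) => x y.
  by rewrite !ipBl !ipBr (ipC ip x y); ring.
rewrite e4; move: h1 e1 e2 e3; rewrite !ler_norml.
move: (ip _ _) (ip _ _) (ip _ _) (ip _ _) (`|_| ^+ 2) => x1 x2 x3 x4 x5.
nra.
Qed.
End increment.

(** * Integrable bounds and increments *)

Section dominated_ftc.
Context {R : realType}.
Notation mu := (@lebesgue_measure R).

Lemma in_Lp_full (X : normedModType R) (S p : R) (f : R -> X) : in_Lp S p f ->
  exists2 E : set (measurableTypeR R), full_set S E &
    (forall k : X -> R, continuous k -> measurable_fun E (k \o f)) /\
    mu.-integrable E (EFin \o (fun t => `|f t| `^ p)).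
Proof.
move=> [/strongly_measurable_full[E fE mf] foo]; exists E => //; split => //.
have [mE ES _] := fE.
have mn : measurable_fun E (fun t => `|f t|) by apply: mf; exact: norm_continuous.
apply/integrableP; split.
  by apply/measurable_EFinP; exact: measurableT_comp (measurable_powR p) mn.
apply: le_lt_trans foo.
rewrite integral_mkcond [leRHS]integral_mkcond; apply: ge0_le_integral_nm => t _.
  by rewrite patchE; case: ifP => // _; rewrite abse_ge0.
rewrite !patchE; case: ifPn => [/set_mem Et|_]; last first.
  by case: ifP => // _; rewrite lee_fin powR_ge0.
by rewrite mem_set ?gee0_abs ?lee_fin ?powR_ge0//; exact: ES.
Qed.

Lemma full_setW (S T : R) (E : set (measurableTypeR R)) : S <= T ->
  full_set T E -> full_set S (E `&` `[0, S]%classic).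
Proof.
move=> ST [mE ET E0]; split; first exact: measurableI.
  by move=> t [].
apply/eqP; rewrite -measure_le0 -E0; apply: le_measure; rewrite ?inE.
- by apply: measurableD => //; exact: measurableI.
- exact: measurableD.
- move=> t [St nE]; split; last by move=> Et; apply: nE.
  by move: St; rewrite /= !in_itv/= => /andP[-> /le_trans->].
Qed.

(** Since |f| <= 1 + |f|^2 and [F] has finite measure, square integrability yields integrability. *)
Lemma integrable_norm_L2 (X : normedModType R) (S : R)
    (E F : set (measurableTypeR R)) (f : R -> X) :
  full_set S F -> measurable E -> F `<=` E ->
  measurable_fun E (fun t => `|f t|) ->
  mu.-integrable E (EFin \o (fun t => `|f t| `^ 2)) ->
  mu.-integrable F (EFin \o (fun t => `|f t|)).
Proof.
move=> fF mE FE mf iE; have [mF _ _] := fF.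
have iF : mu.-integrable F (EFin \o (fun t => `|f t| `^ 2)).
  by apply: integrableS iE.
have i1 : mu.-integrable F (EFin \o cst (1 : R)).
  apply: measurable_bounded_integrable => //; first exact: full_measure_lty fF.
  by exists 1; split => // x x1 t _ /=; rewrite normr1 ltW.
have i2 : mu.-integrable F (EFin \o (fun t => 1 + `|f t| `^ 2)).
  by have := integrableD mF i1 iF.
apply: le_integrable i2 => //.
  by apply/measurable_EFinP; exact: measurable_funS mf.
move=> t _ /=; rewrite lee_fin normr_id ger0_norm ?addr_ge0 ?powR_ge0//.
rewrite powR_mulrn//.
have := sqr_ge0 (`|f t| - 1); rewrite sqrrB1 => h.
have := normr_ge0 (f t); lra.
Qed.

Variables (H : normedModType R) (ip : {dot H for idfun}).
Hypothesis hip : induces_norm ip.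

(** Turns a bound on the derivatives paired with fixed vectors into one on increments. Both scalar
    integrands are extended by zero off [E], where [G] vanishes too, so the inequality persists
    there. *)
Lemma weak_derivative_increment_le (S : R) (E : set (measurableTypeR R))
    (x y wx wy xc yc : R -> H) (G : R -> R) :
  full_set S E -> (forall t, E t -> xc t = x t) -> (forall t, E t -> yc t = y t) ->
  {within `[0, S], continuous xc} -> {within `[0, S], continuous yc} ->
  weak_derivative S x wx -> weak_derivative S y wy ->
  (forall k : H -> R, continuous k -> measurable_fun E (k \o wx)) ->
  (forall k : H -> R, continuous k -> measurable_fun E (k \o wy)) ->
  mu.-integrable setT (EFin \o G) ->
  (forall t, E t -> `|wx t| + `|wy t| <= G t) -> (forall t, ~ E t -> G t = 0) ->
  forall s t, 0 < s -> s < t -> t < S -> forall h1 h2 c,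
    (forall r, E r -> s <= r <= t -> ip (wx r) h1 - ip (wy r) h2 <= c * G r) ->
    ip (xc t - xc s) h1 - ip (yc t - yc s) h2 <= c * \int[mu]_(r in `[s, t]) G r.
Proof.
move=> fE xcE ycE cx cy dx dy mx my iG GE G0 s t s0 st tS h1 h2 c hc.
have [mE _ _] := fE.
have iq (w : R -> H) h : (forall k : H -> R, continuous k -> measurable_fun E (k \o w)) ->
    (forall t, E t -> `|w t| <= G t) ->
    mu.-integrable setT (EFin \o ((fun r => ip (w r) h) \_ E)).
  move=> mw wG.
  have iGh : mu.-integrable setT (EFin \o (fun r => `|h| * G r)).
    by have := integrableZl measurableT `|h| iG.
  apply: le_integrable iGh => //.
    apply/measurable_EFinP; apply: (measurable_restrictT _ mE).1.
    by have := mw (ip^~ h) (@ip_continuous _ _ ip hip h).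
  move=> r _ /=; rewrite lee_fin patchE; case: ifPn => [/set_mem Er|_].
    rewrite normrM normr_id mulrC; apply: le_trans (le_ip hip _ _) _.
    by rewrite ler_wpM2r// (le_trans (wG r Er))// ler_norm.
  by rewrite normr0.
have ix : mu.-integrable setT (EFin \o ((fun r => ip (wx r) h1) \_ E)).
  by apply: iq => // r Er; apply: le_trans (GE r Er); rewrite lerDl.
have iy : mu.-integrable setT (EFin \o ((fun r => ip (wy r) h2) \_ E)).
  by apply: iq => // r Er; apply: le_trans (GE r Er); rewrite lerDr.
rewrite (weak_derivative_ftc hip fE xcE cx dx ix)//; last 2 first.
- by move=> r Er; rewrite patchE mem_set.
- by move=> r Er; rewrite patchE memNset.
rewrite (weak_derivative_ftc hip fE ycE cy dy iy)//; last 2 first.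
- by move=> r Er; rewrite patchE mem_set.
- by move=> r Er; rewrite patchE memNset.
have sub f : mu.-integrable setT (EFin \o f) -> mu.-integrable `[s, t] (EFin \o f).
  by move=> i; apply: integrableS i.
rewrite -RintegralB ?sub// -RintegralZl ?sub//.
apply: le_Rintegral => //.
- by apply: (sub (fun r => _ - _)); have := integrableB measurableT ix iy.
- by apply: (sub (fun r => c * _)); have := integrableZl measurableT c iG.
move=> r /=; rewrite in_itv/= => rst; rewrite !patchE.
case: ifPn => [/set_mem Er|/negP]; first exact: hc.
by rewrite inE => nE; rewrite G0// mulr0 subrr.
Qed.
End dominated_ftc.

(** * Continuity on a closed interval *)

Section within_continuity.
Context {R : realType} {H : normedModType R}.
Implicit Types (S x e : R) (xc yc : R -> H).

Lemma within_continuous_dist S xc x e :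
  {within `[0, S], continuous xc} -> 0 <= x <= S -> 0 < e ->
  exists2 d, 0 < d & forall r, 0 <= r <= S -> `|r - x| < d -> `|xc r - xc x| < e.
Proof.
move=> /subspace_continuousP/(_ x) cx xS e0.
have /cvgrPdist_lt/(_ e e0)[d /= d0 hd] : xc @ within `[0, S] (nbhs x) --> xc x.
  by apply: cx; rewrite /= in_itv.
exists d => // r rS rd; rewrite distrC; apply: hd => /=; first by rewrite distrC.
by rewrite in_itv.
Qed.

(** Used at 0, to identify two continuous representatives, and at the supremum of the times up to
    which two solutions agree. *)
Lemma within_continuous_eq S xc yc x :
  {within `[0, S], continuous xc} -> {within `[0, S], continuous yc} ->
  0 <= x <= S ->
  (forall d, 0 < d -> exists2 r, 0 <= r <= S & `|r - x| < d /\ xc r = yc r) ->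
  xc x = yc x.
Proof.
move=> cx cy xS h; apply/eqP; rewrite -subr_eq0 -normr_le0.
apply/ler_addgt0Pr => e e0; rewrite add0r.
have e2 : 0 < e / 2 by lra.
have [d1 d10 h1] := within_continuous_dist cx xS e2.
have [d2 d20 h2] := within_continuous_dist cy xS e2.
have [r rS [rd rE]] : exists2 r, 0 <= r <= S & `|r - x| < Num.min d1 d2 /\ xc r = yc r.
  by apply: h; rewrite lt_min d10.
move: rd; rewrite lt_min => /andP[rd1 rd2].
have -> : xc x - yc x = (yc r - yc x) - (xc r - xc x).
  by rewrite rE opprB [RHS]addrC subrKA.
apply: le_trans (ler_normB _ _) _.
by have := h1 r rS rd1; have := h2 r rS rd2; lra.
Qed.
End within_continuity.

(** * The constants of (A2) and (A4)(b) near a point of the manifold *)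

Section local_constants.
Context {R : realType} {V H : normedModType R} (ip : {dot H for idfun})
  (j : {linear V -> H}) (T eta : R) (A A1 A2 : R -> V -> dual V)
  (M : set H) (TM : H -> set H) (P : H -> H -> H).
Hypotheses (hip : induces_norm ip) (hM : manifold_assumptions ip j M TM P).

Lemma local_A2 (z : H) : assumption_A2 M P -> M z ->
  exists k d : R, [/\ 0 <= k, 0 < d & forall x y, M x -> M y ->
    `|x - z| < d -> `|y - z| < d ->
    (forall h, `|P x h - P y h| <= k * `|x - y| * `|h|) /\
    `|(x - y) - P x (x - y)| <= k * `|x - y| ^+ 2].
Proof.
move=> hA2 Mz; have [hP _ _] := hM.
(* One natural number encodes both constants of (A2): [n] bounds kappa and 1 / (n+1) is the distance
   threshold, so the property weakens as [n] grows. *)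
pose Q n x y := `|x - y| <= (n.+1%:R : R)^-1 ->
  (forall h, `|P x h - P y h| <= n%:R * `|x - y| * `|h|) /\
    `|(x - y) - P x (x - y)| <= n%:R * `|x - y| ^+ 2.
have Qle k l x y : (k <= l)%N -> Q k x y -> Q l x y.
  move=> kl Qk xyl; have [|h1 h2] := Qk.
    by apply: le_trans xyl _; rewrite lef_pV2 ?posrE// ler_nat.
  have kl' : k%:R <= l%:R :> R by rewrite ler_nat.
  split=> [h|].
    by apply: le_trans (h1 h) _; rewrite !ler_wpM2r.
  by apply: le_trans h2 _; rewrite ler_wpM2r// exprn_ge0.
have QM M' : M' `<=` M -> weakly_compact M' -> exists k, forall x y, M' x -> M' y -> Q k x y.
  move=> M'M wM'; have [k [e [e0 ke]]] := hA2 _ M'M wM'.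
  exists (maxn (Num.trunc `|k|).+1 (Num.trunc e^-1).+1) => x y M'x M'y.
  set n := maxn _ _ => xyn.
  have kn : k <= n%:R.
    apply: le_trans (ler_norm _) _; apply: ltW; apply: lt_le_trans (truncnS_gt _) _.
    by rewrite ler_nat leq_maxl.
  have en : `|x - y| <= e.
    apply: le_trans xyn _; rewrite invf_ple ?posrE//.
    apply: ltW; apply: lt_le_trans (truncnS_gt _) _.
    by rewrite ler_nat (leq_trans (leq_maxr _ _) (leqnSn _)).
  have [h1 h2] := ke x y M'x M'y en.
  have [csx oPx _] := hP _ (M'M _ M'x); have [csy oPy _] := hP _ (M'M _ M'y).
  split=> [h|].
    have := @opnorm_le _ _ _ (P x \- P y)%R (k * `|x - y|) h _ h1.
    move=> /(_ _)/le_trans; apply.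
      by move=> c v /=; rewrite !(projZ hip csx oPx) !(projZ hip csy oPy) scalerBr.
    by rewrite !ler_wpM2r.
  by apply: le_trans h2 _; rewrite ler_wpM2r// exprn_ge0.
have [k [d d0 hk]] := local_constant Qle QM Mz.
(* Half the threshold as radius keeps any two points of the ball within the threshold of each
   other. *)
exists k%:R, (Num.min d (k.+1%:R^-1 / 2)); split => //.
  by rewrite lt_min d0 divr_gt0// invr_gt0.
move=> x y Mx My; rewrite !lt_min => /andP[xd xk] /andP[yd yk].
apply: (hk x y Mx My xd yd).
rewrite (_ : x - y = (x - z) - (y - z)); last by rewrite opprB subrKA.
apply: le_trans (ler_normB _ _) _.
by move: (k.+1%:R^-1) xk yk => ik xk yk; lra.
Qed.

Lemma local_A4 (z : H) : assumption_A4 ip j M P T A A1 A2 eta -> M z ->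
  exists g d : R, [/\ 0 <= g, 0 < d & forall t x, t \in `[0, T] -> M (j x) ->
    `|j x - z| < d -> exists2 h, (forall v, pairing (A2 t x) v = ip h (j v)) &
      `|h| <= g * `|x| `^ eta].
Proof.
move=> [_ _ _ hA4] Mz.
pose Q n (y _ : H) := forall t x, t \in `[0, T] -> j x = y ->
  exists2 h, (forall v, pairing (A2 t x) v = ip h (j v)) &
      `|h| <= n%:R * `|x| `^ eta.
have Qle k l x y : (k <= l)%N -> Q k x y -> Q l x y.
  move=> kl Qk t v tT vx; have [h h1 h2] := Qk t v tT vx; exists h => //.
  by apply: le_trans h2 _; rewrite ler_wpM2r ?powR_ge0// ler_nat.
have QM M' : M' `<=` M -> weakly_compact M' -> exists k, forall x y, M' x -> M' y -> Q k x y.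
  move=> M'M wM'; have [g g0 hg] := hA4 _ M'M wM'.
  exists (Num.trunc g).+1 => x y M'x _ t v tT vx.
  have [|h h1 h2] := hg t v tT; first by rewrite vx.
  exists h => //; apply: le_trans h2 _; rewrite ler_wpM2r ?powR_ge0//.
  exact/ltW/truncnS_gt.
have [k [d d0 hk]] := local_constant Qle QM Mz.
exists k%:R, d; split => // t x tT Mx xz.
exact: (hk (j x) (j x) Mx Mx xz xz t x tT erefl).
Qed.
End local_constants.

(** Letting [s] decrease to [tau] and [t] increase to [c] within [D] gives phi(c) <= phi(c) / 2. *)
Lemma half_increment_le0 (R : realType) (phi : R -> R) (D : set R)
    (tau sigma c : R) :
  {within `[tau, sigma], continuous phi} -> phi tau = 0 -> tau <= c <= sigma ->
  (forall a b, tau <= a -> a < b -> b <= sigma -> exists2 t, D t & a < t < b) ->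
  (forall s t, D s -> D t -> tau < s -> s < t -> t < sigma ->
    phi t - phi s <= phi c / 2) ->
  phi c <= 0.
Proof.
move=> cphi phi0 /andP[]; rewrite le_eqVlt => /predU1P[<- _ _ _|tc cs dD key].
  by rewrite phi0.
suff : phi c <= phi c / 2 by lra.
apply/ler_addgt0Pr => q q0.
have q2 : 0 < q / 2 by lra.
have cdist x : tau <= x <= sigma -> exists2 b, 0 < b & forall r, tau <= r <= sigma ->
    `|r - x| < b -> `|phi r - phi x| < q / 2.
  move=> xx; move/subspace_continuousP: (cphi) => /(_ x).
  rewrite /= in_itv/= => /(_ xx)/cvgrPdist_lt/(_ _ q2)[b /= b0 hb].
  exists b => // r rr rx; rewrite distrC; apply: hb; first by rewrite /= distrC.
  by rewrite /= in_itv.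
have [p1 p10 hp1] := cdist c ltac:(by rewrite (ltW tc)).
have [p2 p20 hp2] := cdist tau ltac:(by rewrite lexx ltW// (lt_le_trans tc)).
have [t Dt /andP[t1 t2]] : exists2 t, D t & Num.max tau (c - p1) < t < c.
  by apply: dD; rewrite ?le_max ?lexx// gt_max tc; lra.
move: t1; rewrite gt_max => /andP[t1 t1'].
have [s Ds /andP[s1 s2]] : exists2 s, D s & tau < s < Num.min t (tau + p2).
  apply: dD => //; first by rewrite lt_min t1; lra.
  by rewrite ge_min (le_trans (ltW t2) cs).
move: s2; rewrite lt_min => /andP[s2 s2'].
have := key s t Ds Dt s1 s2 (lt_le_trans t2 cs).
have := hp1 t ltac:(by apply/andP; split; lra) ltac:(by rewrite ltr_norml; apply/andP; split; lra).
have := hp2 s ltac:(by apply/andP; split; lra) ltac:(by rewrite ltr_norml; apply/andP; split; lra).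
by rewrite phi0 subr0 !ltr_norml => /andP[_ h1] /andP[h2 _] h3; lra.
Qed.

(** * Agreement just after a common value *)

Section local_uniqueness.
Context {R : realType} {V H : normedModType R} (ip : {dot H for idfun})
  (j : {linear V -> H}).
Notation mu := (@lebesgue_measure R).
Variables (T : R) (a : R -> {symmetric V}) (beta m0 L : R)
  (A A1 A2 : R -> V -> dual V) (M : set H) (TM : H -> set H) (P : H -> H -> H)
  (eta : R) (f : R -> H) (S : R) (u v : R -> V) (uc vc wu wv : R -> H)
  (E : set (measurableTypeR R)) (G : R -> R).
Hypotheses (hip : induces_norm ip)
  (ha : form_assumptions T a beta m0 L) (hA : represents_form T a A)
  (hM : manifold_assumptions ip j M TM P) (hA2 : assumption_A2 M P)
  (hA3 : assumption_A3 j M TM P) (hA4 : assumption_A4 ip j M P T A A1 A2 eta)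
  (ST : S <= T) (fE : full_set S E)
  (cu : {within `[0, S], continuous uc}) (cv : {within `[0, S], continuous vc})
  (ucE : forall t, E t -> uc t = j (u t)) (vcE : forall t, E t -> vc t = j (v t))
  (uM : forall t, E t -> M (j (u t))) (vM : forall t, E t -> M (j (v t)))
  (equ : forall t, E t -> forall x, TM (j (u t)) (j x) ->
    ip (wu t) (j x) + a t (u t) x = ip (f t) (j x))
  (eqv : forall t, E t -> forall x, TM (j (v t)) (j x) ->
    ip (wv t) (j x) + a t (v t) x = ip (f t) (j x))
  (iG : mu.-integrable setT (EFin \o G)) (G0 : forall t, 0 <= G t)
  (GE : forall t, E t ->
    `|wu t| + `|wv t| + `|f t| + `|u t| `^ eta + `|v t| `^ eta <= G t)
  (ftc : forall s t, 0 < s -> s < t -> t < S -> forall h1 h2 c,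
    (forall r, E r -> s <= r <= t -> ip (wu r) h1 - ip (wv r) h2 <= c * G r) ->
    ip (uc t - uc s) h1 - ip (vc t - vc s) h2 <= c * \int[mu]_(r in `[s, t]) G r).

Let I s t := \int[mu]_(r in `[s, t]) G r.
Let d t := uc t - vc t.

Let GE_w t : E t -> [/\ `|wu t| + `|wv t| <= G t, `|f t| <= G t,
  `|wu t| <= G t, `|wv t| <= G t & `|f t| + `|u t| `^ eta + `|v t| `^ eta <= G t].
Proof.
move=> Et; have := GE Et; have := powR_ge0 `|u t| eta; have := powR_ge0 `|v t| eta.
have := normr_ge0 (wu t); have := normr_ge0 (wv t); have := normr_ge0 (f t).
move: `|wu t| `|wv t| `|f t| (`|u t| `^ eta) (`|v t| `^ eta) => *; split; lra.
Qed.

Let ip0r x : ip x 0 = 0.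
Proof. by rewrite -(subrr (0 : H)) ipBr subrr. Qed.

Let uI s r t : 0 < s -> t < S -> s <= r <= t -> `|uc r - uc s| <= I s t.
Proof.
move=> s0 tS /andP[]; rewrite le_eqVlt => /predU1P[<- _|sr rt].
  by rewrite subrr normr0 Rintegral_itv_ge0.
apply: (@le_trans _ _ (I s r)); last first.
  by rewrite /I (Rintegral_split iG (ltW sr) rt) lerDl Rintegral_itv_ge0.
(* The increment is tested with itself: |h|^2 is at most |h| times the integral of [G]. *)
set h := uc r - uc s; have [->|h0] := eqVneq h 0; first by rewrite normr0 Rintegral_itv_ge0.
have hp : 0 < `|h| by rewrite normr_gt0.
rewrite -(ler_pM2l hp) -expr2 -hip.
have := @ftc s r s0 sr (le_lt_trans rt tS) h 0 `|h|; rewrite ip0r subr0; apply.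
move=> r' Er' _; rewrite ip0r subr0; apply: le_trans (ip_le hip _ _) _.
by rewrite mulrC ler_wpM2l//; have [] := GE_w Er'.
Qed.

Let vI s r t : 0 < s -> t < S -> s <= r <= t -> `|vc r - vc s| <= I s t.
Proof.
move=> s0 tS /andP[]; rewrite le_eqVlt => /predU1P[<- _|sr rt].
  by rewrite subrr normr0 Rintegral_itv_ge0.
apply: (@le_trans _ _ (I s r)); last first.
  by rewrite /I (Rintegral_split iG (ltW sr) rt) lerDl Rintegral_itv_ge0.
set h := vc r - vc s; have [->|h0] := eqVneq h 0; first by rewrite normr0 Rintegral_itv_ge0.
have hp : 0 < `|h| by rewrite normr_gt0.
rewrite -(ler_pM2l hp) -expr2 -hip.
(* In [ftc] the second function carries a minus sign, hence the test vector [- h]. *)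
have := @ftc s r s0 sr (le_lt_trans rt tS) 0 (- h) `|h|.
rewrite ip0r sub0r ipC ipNl opprK; apply.
move=> r' Er' _; rewrite ip0r sub0r ipC ipNl opprK; apply: le_trans (ip_le hip _ _) _.
by rewrite ler_wpM2l//; have [] := GE_w Er'.
Qed.

Section near_point.
Variables (z : H) (k g e lo hi m : R).
Hypotheses (k0 : 0 <= k) (g0 : 0 <= g) (lo0 : 0 <= lo) (hiS : hi < S)
  (kP : forall x y, M x -> M y -> `|x - z| < e -> `|y - z| < e ->
    (forall h, `|P x h - P y h| <= k * `|x - y| * `|h|) /\
    `|(x - y) - P x (x - y)| <= k * `|x - y| ^+ 2)
  (gP : forall t x, t \in `[0, T] -> M (j x) -> `|j x - z| < e ->
    exists2 h, (forall y, pairing (A2 t x) y = ip h (j y)) &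
      `|h| <= g * `|x| `^ eta)
  (uz : forall r, lo <= r <= hi -> `|uc r - z| < e)
  (vz : forall r, lo <= r <= hi -> `|vc r - z| < e)
  (e2 : e + e <= 1)
  (dm : forall r, lo <= r <= hi -> `|d r| ^+ 2 <= m).

Let EM r : E r -> M (uc r) /\ M (vc r).
Proof. by move=> Er; rewrite ucE// vcE//; split; [exact: uM|exact: vM]. Qed.

(** Supplies the hypothesis [main] of [increment_le]. By (A4)(b), |f| + |A_2 u| + |A_2 v| <= (1 + g)
    G, and |d|^2 <= m. *)
Let PE r : E r -> lo <= r <= hi ->
  ip (wu r) (P (uc r) (d r)) - ip (wv r) (P (vc r) (d r)) <=
    k * (1 + g) * m * G r.
Proof.
move=> Er rr; have [mE ES _] := fE.
have rT : r \in `[0, T].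
  by have := ES _ Er; rewrite /= !in_itv/= => /andP[-> /le_trans->].
have [Mu Mv] := EM Er; have := uz rr; have := vz rr.
have [hA4a hA4b _ _] := hA4.
rewrite /d; rewrite ucE// vcE// in Mu Mv * => vzr uzr.
have [gu hgu gul] := gP rT Mu uzr.
have [gv hgv gvl] := gP rT Mv vzr.
have [Pl Pu] := kP Mu Mv uzr vzr.
have [_ Pv] := kP Mv Mu vzr uzr.
have [hP _ _] := hM; have [csv oPv _] := hP _ Mv.
have Puv : `|P (j (u r)) (j (u r) - j (v r)) - P (j (v r)) (j (u r) - j (v r))| <=
    k * `|j (u r) - j (v r)| ^+ 2.
  by apply: le_trans (Pl _) _; rewrite -mulrA -expr2.
have Pv' : `|j (u r) - j (v r) - P (j (v r)) (j (u r) - j (v r))| <=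
    k * `|j (u r) - j (v r)| ^+ 2.
  by rewrite (proj_defectC hip csv oPv) [`|j (u r) - _|]distrC.
have := projected_difference_le hip ha hA hA3 hA4a hA4b rT Mu Mv (equ Er) (eqv Er) hgu hgv Puv Pu Pv'.
move=> /le_trans; apply.
have dmr : `|j (u r) - j (v r)| ^+ 2 <= m by have := dm rr; rewrite /d ucE// vcE.
have -> : k * (1 + g) * m * G r = k * ((1 + g) * G r) * m by ring.
have [_ fG _ _ Gr] := GE_w Er.
have h1 : 0 <= g * (G r - (`|f r| + `|u r| `^ eta + `|v r| `^ eta)).
  by rewrite mulr_ge0// subr_ge0.
have h2 : 0 <= g * `|f r| by rewrite mulr_ge0.
have h3 : `|f r| + `|gu| + `|gv| <= (1 + g) * G r by lra.
by apply: ler_pM; rewrite ?mulr_ge0 ?addr_ge0 ?exprn_ge0// ler_wpM2l.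
Qed.

Lemma difference_increment_le s t : E s -> E t -> lo < s -> s < t -> t < hi ->
  `|d t| ^+ 2 - `|d s| ^+ 2 <= 2 * (k * (1 + g)) * m * I s t.
Proof.
move=> Es0 Et0 los0 st0 thi0.
have K0 : 0 <= 8 + 6 * k by rewrite addr_ge0// mulr_ge0.
have dense_E a' b' : lo < a' -> a' < b' -> b' < hi -> exists2 r, E r & a' < r < b'.
  move=> l1 l2 l3; apply: (full_dense fE) => //; first exact: le_trans lo0 (ltW l1).
  exact: ltW (lt_trans l3 hiS).
apply: (quadratic_increment (Psi := fun t => `|d t| ^+ 2) iG G0 K0 dense_E) Es0 Et0 los0 st0 thi0.
move=> s' t' Es Et los st thi.
have s0 : 0 < s' by apply: le_lt_trans los.
have tS : t' < S by apply: lt_trans thi hiS.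
have inr r : s' <= r <= t' -> lo <= r <= hi.
  by move=> /andP[? ?]; apply/andP; split; lra.
have ss : s' <= s' <= t' by rewrite lexx ltW.
have tt : s' <= t' <= t' by rewrite lexx ltW.
have [hP _ _] := hM.
have C0 : 0 <= k * (1 + g) by rewrite mulr_ge0 ?addr_ge0.
have II : 0 <= I s' t' by exact: Rintegral_itv_ge0.
have [Mus Mvs] := EM Es; have [Mut Mvt] := EM Et.
have [csu oPu _] := hP _ Mus; have [csv oPv _] := hP _ Mvs.
apply: (@increment_le _ _ ip hip P uc vc wu wv E G (I s' t') (k * (1 + g)) k m s' t') => //.
- move=> r Er rst; have [Mur Mvr] := EM Er.
  have [c1 o1 _] := hP _ Mur; have [c2 o2 _] := hP _ Mvr.
  split=> [x y|x y|x|x]; [exact: (projB hip c1 o1)|exact: (projB hip c2 o2)|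
    exact: (proj_le hip o1)|exact: (proj_le hip o2)].
- exact: (proj_sym oPu).
- exact: (proj_sym oPv).
- by move=> r Er _; have [] := GE_w Er.
- by move=> r _ rst; exact: uI.
- by move=> r _ rst; exact: vI.
- by move=> h1 h2 c hc; apply: ftc.
- move=> r Er rst h; have [Mur _] := EM Er.
  by rewrite -(distrC (uc s')); apply: (kP Mus Mur _ _).1; apply: uz; exact: inr.
- move=> r Er rst h; have [_ Mvr] := EM Er.
  by rewrite -(distrC (vc s')); apply: (kP Mvs Mvr _ _).1; apply: vz; exact: inr.
- have [_] := kP Mus Mut (uz (inr _ ss)) (uz (inr _ tt)).
  by rewrite (proj_defectC hip csu oPu) [`|uc s' - _|]distrC.
- have [_] := kP Mvs Mvt (vz (inr _ ss)) (vz (inr _ tt)).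
  by rewrite (proj_defectC hip csv oPv) [`|vc s' - _|]distrC.
- move=> r Er rst; have -> : uc r - vc r = (uc r - z) - (vc r - z) by rewrite opprB subrKA.
  apply: le_trans (ler_normB _ _) _.
  apply: le_trans (lerD (ltW (uz (inr _ rst))) (ltW (vz (inr _ rst)))) _.
  exact: e2.
- by move=> r Er rst; apply: PE => //; exact: inr.
Qed.
End near_point.

Lemma local_uniqueness (tau : R) : 0 <= tau < S -> uc tau = vc tau ->
  M (uc tau) -> exists2 sigma, tau < sigma <= S &
    forall t, tau <= t <= sigma -> uc t = vc t.
Proof.
move=> /andP[tau0 tauS] uv Mz.
have [k [d1 [k0 d10 kP]]] := local_A2 hip hM hA2 Mz.
have [g [d2 [g0 d20 gP]]] := local_A4 hA4 Mz.
(* The bound 1 / 2 makes |u - v| at most 1 as long as both stay within [e] of the common value. *)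
pose e := Num.min (Num.min d1 d2) (1 / 2).
have [e0 ed1 ed2 e2] : [/\ 0 < e, e <= d1, e <= d2 & e <= 1 / 2].
  by split; rewrite ?lt_min ?d10 ?d20 ?ge_min ?lexx ?orbT//=; lra.
have tauS' : 0 <= tau <= S by rewrite tau0 ltW.
have [b1 b10 hb1] := within_continuous_dist cu tauS' e0.
have [b2 b20 hb2] := within_continuous_dist cv tauS' e0.
pose C := 2 * (k * (1 + g)).
have C0 : 0 <= C by rewrite !mulr_ge0 ?addr_ge0.
(* An integral of [G] below this value makes [C] times it at most 1 / 2, the factor needed by
   [half_increment_le0]. *)
have C4 : 0 < 1 / (2 * (C + 1)) by rewrite divr_gt0// mulr_gt0// ltr_wpDl.
have [b3 b30 hb3] := Rintegral_itv_small iG G0 C4.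
pose b := Num.min (Num.min b1 b2) (Num.min b3 (S - tau)).
have [b0 bb1 bb2 bb3 bbS] : [/\ 0 < b, b <= b1, b <= b2, b <= b3 & b <= S - tau].
  by split; rewrite ?lt_min ?ge_min ?lexx ?orbT//= b10 b20 b30 subr_gt0.
(* Half of [b] keeps [sigma] strictly below [S] and every point of the interval at distance less
   than [b] from [tau]. *)
pose sigma := tau + b / 2.
exists sigma; first by apply/andP; rewrite /sigma; split; lra.
have cd : {within `[tau, sigma], continuous (fun t => `|d t| ^+ 2)}.
  have sub : `[tau, sigma] `<=` `[0, S].
    by move=> r; rewrite /= !in_itv/= /sigma => /andP[? ?]; apply/andP; split; lra.
  have cu' := continuous_subspaceW sub cu; have cv' := continuous_subspaceW sub cv.
  rewrite (_ : (fun t => _) = (fun t => `|d t| * `|d t|)); last first.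
    by apply/funext => r; rewrite expr2.
  by move=> r; apply: cvgM; apply: cvg_norm; exact: cvgB (cu' r) (cv' r).
have ts : tau <= sigma by rewrite /sigma; lra.
(* The maximum of |d|^2 serves as [m] in the increment bound, which then controls the maximum by
   half of itself. *)
have [c cts hc] := EVT_max ts cd.
have dm r : tau <= r <= sigma -> `|d r| ^+ 2 <= `|d c| ^+ 2.
  by move=> rr; apply: hc; rewrite in_itv.
have inS r : tau <= r <= sigma -> 0 <= r <= S.
  by rewrite /sigma => /andP[? ?]; apply/andP; split; lra.
have inb r : tau <= r <= sigma -> `|r - tau| < b.
  by rewrite /sigma => /andP[? ?]; rewrite ltr_norml; apply/andP; split; lra.
have sigmaS : sigma < S by rewrite /sigma; lra.
have key s t : E s -> E t -> tau < s -> s < t -> t < sigma ->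
    `|d t| ^+ 2 - `|d s| ^+ 2 <= `|d c| ^+ 2 / 2.
  move=> Es Et ls st tl.
  have e2' : e + e <= 1 by lra.
  have := @difference_increment_le (uc tau) k g e tau sigma (`|d c| ^+ 2)
    k0 g0 tau0 sigmaS _ _ _ _ e2' dm s t Es Et ls st tl.
  move=> /(_ _ _ _ _)/le_trans; apply.
  - move=> x y Mx My xz yz; apply: kP => //; exact: lt_le_trans ed1.
  - move=> r x rT Mx xz; apply: gP => //; exact: lt_le_trans ed2.
  - by move=> r rr; apply: hb1; [exact: inS|apply: lt_le_trans (inb r rr) bb1].
  - by move=> r rr; rewrite uv; apply: hb2; [exact: inS|apply: lt_le_trans (inb r rr) bb2].
  rewrite -/C; have : I s t < 1 / (2 * (C + 1)).
    by apply: hb3; rewrite /sigma in tl; lra.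
  rewrite ltr_pdivlMr ?mulr_gt0 ?ltr_wpDl// => It.
  have I0 : 0 <= I s t by exact: Rintegral_itv_ge0.
  rewrite mulrAC mulrC ler_wpM2l ?exprn_ge0//; lra.
have dtau : `|d tau| ^+ 2 = 0 by rewrite /d uv subrr normr0 expr0n.
have dc0 : `|d c| ^+ 2 <= 0.
  move: cts; rewrite in_itv/= => cts.
  apply: (half_increment_le0 cd dtau cts _ key) => a' b' h1 h2 h3.
  apply: (full_dense fE) => //; first exact: le_trans h1.
  exact/ltW/(le_lt_trans h3).
move=> t tt; apply/eqP; rewrite -subr_eq0 -normr_eq0 -sqrf_eq0 eq_le exprn_ge0// andbT.
exact: le_trans (dm t tt) dc0.
Qed.
End local_uniqueness.

(** * Uniqueness on the whole interval *)

Unset Implicit Arguments.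

Theorem theorem4p1 (R : realType) (V H : completeNormedModType R)
  (ipV : {dot V for idfun}) (ipH : {dot H for idfun}) (j : {linear V -> H})
  (T : R) (a : R -> {symmetric V}) (beta mu L : R)
  (A A1 A2 : R -> V -> dual V)
  (M : set H) (TM : H -> set H) (P : H -> H -> H) (eta : R)
  (f : R -> H) (u0 : V) (Ts : R) (u : R -> V) (uc : R -> H)
  (ipVE : induces_norm ipV) (ipHE : induces_norm ipH)
  (VH : gelfand_compact j)
  (T_gt0 : 0 < T)
  (ha : form_assumptions T a beta mu L)
  (hA : represents_form T a A)
  (hM : manifold_assumptions ipH j M TM P)
  (hA1 : assumption_A1 M)
  (hA2 : assumption_A2 M P)
  (hA3 : assumption_A3 j M TM P)
  (hA4 : assumption_A4 ipH j M P T A A1 A2 eta)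
  (hf : in_Lp T 2 f)
  (hu0 : M (j u0))
  (Ts_gt0 : 0 < Ts) (Ts_leT : Ts <= T)
  (hu : solution_P ipH j a M TM f u0 Ts u)
  (huc : continuous_representative Ts (j \o u) uc)
  (ucM : forall t : R, 0 <= t < Ts -> M (uc t))
  (hu_eta : in_Lp Ts eta u) :
  forall v : R -> V,
    solution_P ipH j a M TM f u0 Ts v -> in_Lp Ts eta v ->
    aeI Ts (fun t => v t = u t).
Proof.
move=> v hv hv_eta.
have [wu [[_ Lwu dwu] [uc' [cuc' uc'E] uc'0] solu]] := hu.
have [wv [[_ Lwv dwv] [vc [cvc vcE] vc0] solv]] := hv.
have [cuc ucE] := huc.
have [E1 fE1 sE1] := aeI_full solu; have [E2 fE2 sE2] := aeI_full solv.
have [E3 fE3 sE3] := aeI_full ucE; have [E4 fE4 sE4] := aeI_full vcE.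
have [E5 fE5 sE5] := aeI_full uc'E.
have [F1 fF1 [mF1 iF1]] := in_Lp_full Lwu; have [F2 fF2 [mF2 iF2]] := in_Lp_full Lwv.
(* [f] is given on [0, T], so its set of full measure is cut down to [0, Ts]. *)
have [F3 fF3' [mF3 iF3]] := in_Lp_full hf; have fF3 := full_setW Ts_leT fF3'.
have [F4 fF4 [_ iF4]] := in_Lp_full hu_eta; have [F5 fF5 [_ iF5]] := in_Lp_full hv_eta.
pose E : set (measurableTypeR R) := E1 `&` (E2 `&` (E3 `&` (E4 `&`
  (F1 `&` (F2 `&` ((F3 `&` `[0, Ts]%classic) `&` (F4 `&` F5))))))).
have fE : full_set Ts E by do 7!(apply: full_setI => //); exact: full_setI.
have [mE ES _] := fE.
have EE t : E t -> [/\ E1 t, E2 t, E3 t & E4 t] by move=> [? [? [? [? _]]]].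
have [EF1 EF2 EF3 EF4 EF5] : [/\ E `<=` F1, E `<=` F2, E `<=` F3, E `<=` F4 & E `<=` F5].
  by split=> t [_ [_ [_ [_ [? [? [[? _] [? ?]]]]]]]].
have [[mF1' _ _] [mF2' _ _] [mF3' _ _] [mF4' _ _] [mF5' _ _]] := And5 fF1 fF2 fF3' fF4 fF5.
have nc : continuous (@Num.norm R H) by exact: norm_continuous.
have i1 := integrable_norm_L2 fE mF1' EF1 (mF1 _ nc) iF1.
have i2 := integrable_norm_L2 fE mF2' EF2 (mF2 _ nc) iF2.
have i3 := integrable_norm_L2 fE mF3' EF3 (mF3 _ nc) iF3.
have i4 := integrableS mF4' mE EF4 iF4.
have i5 := integrableS mF5' mE EF5 iF5.
pose g t := `|wu t| + `|wv t| + `|f t| + `|u t| `^ eta + `|v t| `^ eta.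
have ig : lebesgue_measure.-integrable E (EFin \o g).
  by have := integrableD mE (integrableD mE (integrableD mE (integrableD mE i1 i2) i3) i4) i5.
(* Extension by zero makes the dominating function integrable on the whole line. *)
pose G := g \_ E.
have iG : lebesgue_measure.-integrable setT (EFin \o G).
  by rewrite -restrict_EFin; apply/integrable_restrict => //; rewrite setTI.
have g0 t : 0 <= g t by rewrite !addr_ge0 ?powR_ge0.
have G0 t : 0 <= G t by rewrite /G patchE; case: ifP.
have GE t : E t -> g t <= G t by move=> Et; rewrite /G patchE mem_set.
have GnE t : ~ E t -> G t = 0 by move=> nE; rewrite /G patchE memNset.
have GEw t : E t -> `|wu t| + `|wv t| <= G t.
  move=> Et; apply: le_trans (GE t Et); rewrite /g -!addrA lerD2l lerDl.
  by rewrite !addr_ge0 ?powR_ge0.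
have ucjE t : E t -> uc t = j (u t) by move=> /EE[_ _ /sE3].
have vcjE t : E t -> vc t = j (v t) by move=> /EE[_ _ _ /sE4].
have mw (w : R -> H) (F : set (measurableTypeR R)) : measurable F -> E `<=` F ->
    (forall k : H -> R, continuous k -> measurable_fun F (k \o w)) ->
    forall k : H -> R, continuous k -> measurable_fun E (k \o w).
  by move=> mF EF mFw k ck; apply: measurable_funS (mFw k ck).
have ftc := weak_derivative_increment_le ipHE fE ucjE vcjE cuc cvc dwu dwv
  (mw _ _ mF1' EF1 mF1) (mw _ _ mF2' EF2 mF2) iG GEw GnE.
have local := local_uniqueness ipHE ha hA hM hA2 hA3 hA4 Ts_leT fE cuc cvc ucjE vcjE
  (fun t Et => (sE1 t (let: And4 h _ _ _ := EE t Et in h)).1)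
  (fun t Et => (sE2 t (let: And4 _ h _ _ := EE t Et in h)).1)
  (fun t Et => (sE1 t (let: And4 h _ _ _ := EE t Et in h)).2)
  (fun t Et => (sE2 t (let: And4 _ h _ _ := EE t Et in h)).2) iG G0 GE ftc.
(* [uc] is the prescribed representative, while the initial value comes with [uc']. They agree at
   points arbitrarily close to 0, hence at 0. *)
have uv0 : uc 0 = vc 0.
  rewrite vc0 -uc'0; apply: (within_continuous_eq cuc cuc'); first by rewrite lexx ltW.
  move=> e e0; have [t [t3 t5] /andP[t0 te]] : exists2 t, (E3 `&` E5) t & 0 < t < Num.min e Ts.
    apply: (full_dense (full_setI fE3 fE5)) => //; first by rewrite lt_min e0.
    by rewrite ge_min lexx orbT.
  move: te; rewrite lt_min => /andP[te tT]; exists t; first by rewrite !ltW.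
  by rewrite subr0 gtr0_norm// sE3// sE5.
have uvT t : 0 <= t <= Ts -> uc t = vc t.
  (* Continuation: the supremum [tau] of the times up to which the solutions agree is attained by
     continuity and cannot be less than [Ts]. *)
  pose A' := [set t | 0 <= t <= Ts /\ forall r, 0 <= r <= t -> uc r = vc r].
  have A0 : A' 0.
    by split=> [|r]; [rewrite lexx ltW|rewrite -eq_le => /eqP <-].
  have supA : has_sup A' by split; [exists 0|exists Ts => r [/andP[]]].
  pose tau := sup A'.
  have tau0 : 0 <= tau by apply: ub_le_sup => //; case: supA.
  have tauT : tau <= Ts by apply: ge_sup; [exists 0|move=> r [/andP[]]].
  have below r : 0 <= r -> r < tau -> uc r = vc r.
    move=> r0 rt; have [|r' [_ Ar'] rr'] := sup_adherent (_ : 0 < tau - r) supA.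
      by rewrite subr_gt0.
    by apply: Ar'; rewrite r0 ltW//; move: rr'; rewrite /tau subKr.
  have attau : uc tau = vc tau.
    have [<-//|tau_n0] := eqVneq 0 tau.
    have taup : 0 < tau by rewrite lt_neqAle tau_n0.
    apply: (within_continuous_eq cuc cvc); first by rewrite tau0.
    (* A point just to the left of [tau], clipped at 0. *)
    move=> e e0; exists (Num.max 0 (tau - e / 2)).
      by rewrite le_max lexx/= ge_max ltW//=; lra.
    split; last by apply: below; rewrite ?le_max ?lexx// gt_max taup; lra.
    rewrite ltr_norml; case: (leP 0 (tau - e / 2)) => h; apply/andP; split; lra.
  have upto r : 0 <= r <= tau -> uc r = vc r.
    by move=> /andP[r0]; rewrite le_eqVlt => /predU1P[->//|]; exact: below.
  move=> /andP[t0 tT]; apply: (upto t); rewrite t0/=; apply: le_trans tT _.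
  rewrite leNgt; apply/negP => tau_lt.
  have tauTs : 0 <= tau < Ts by rewrite tau0.
  (* [M (uc tau)] holds because [tau] is less than [Ts]. Agreement up to some [s] beyond [tau]
     contradicts the supremum. *)
  have [s /andP[s1 s2] hs] := local tau tauTs attau (ucM tau tauTs).
  have : s <= tau.
    apply: ub_le_sup; first by case: supA.
    split; first by rewrite s2 andbT (le_trans tau0) ?ltW.
    move=> r /andP[r0 rs]; have [rt|rt] := leP r tau; first by apply: (upto r); rewrite r0.
    by apply: hs; rewrite rs ltW.
  by rewrite leNgt s1.
(* Equality holds in H; injectivity of the embedding transfers it to V on the full set. *)
have [jinj _ _] := VH.
apply: (full_aeI fE) => t Et; apply: jinj.
by rewrite -vcjE// -ucjE// uvT//; have := ES t Et; rewrite /= in_itv.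
Qed.
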